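(* Right multiplication (with respect to the inner product) with $\tilde\Xi:=\sum_{n\ge0}\tilde\Xi^n$, that is, the linear map sending each $\varphi\in\mathcal{D}_n$ to $\varphi\,\tilde\Xi^n$ (product in $KS_n$) for all $n\ge 0$, is a graded epimorphism of bialgebras $(\mathcal{D},\star,\downarrow)\to(\mathcal{P},\star,\downarrow)$. In particular, $\mathcal{P}_n=\mathcal{D}_n\tilde\Xi^n$ is a left ideal of $\mathcal{D}_n$ for all $n\ge0$. Furthermore, $\tilde\Xi^q=\Xi^q\,\tilde\Xi^n$ for all $n\in\mathbb{N}_0$ and all compositions $q$ of $n$.
   Context: $K$ is a field of characteristic $0$. Permutations act on the right ($i\pi$ is the image of $i$) and products $\pi\sigma$ in $S_n$ are read from left to right (first $\pi$, then $\sigma$). For $\pi\in S_n$: $\mathrm{Des}(\pi)=\{1\le i\le n-1\mid i\pi>(i+1)\pi\}$, $\mathrm{Peak}(\pi)=\{2\le i\le n-1\mid (i-1)\pi<i\pi>(i+1)\pi\}$. For $D\subseteq\{1,\ldots,n-1\}$ let $\Delta^D=\sum_{\mathrm{Des}(\pi)=D}\pi\in KS_n$ and $\Xi^D=\sum_{E\subseteq D}\Delta^E$; $\mathcal{D}_n$ is the span of the $\Delta^D$ (a subalgebra of $KS_n$ by Solomon) and $\mathcal{D}=\bigoplus_{n\ge0}\mathcal{D}_n$. A composition of $n$ is a word $q=q_1.\cdots.q_k$ of positive integers with sum $n$; $D(q)=\{q_1,q_1+q_2,\ldots,q_1+\cdots+q_{k-1}\}$ and $\Xi^q=\Xi^{D(q)}$.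 The Hopf algebra $(\mathcal{D},\star,\downarrow)$ is given by $\Xi^r\star\Xi^q=\Xi^{r.q}$ (concatenation) and the algebra homomorphism $\downarrow$ with $\Xi^n\!\downarrow=\sum_{k=0}^n\Xi^k\otimes\Xi^{n-k}$, where $\Xi^0$ is the empty permutation. $\mathcal{P}_n\subseteq\mathcal{D}_n$ is the span of the elements $\Pi^P=\sum_{\pi\in S_n,\ \mathrm{Peak}(\pi)=P}\pi$, $P\subseteq\{2,\ldots,n-1\}$, and $\mathcal{P}=\bigoplus_{n\ge0}\mathcal{P}_n$, which is a sub-bialgebra of $(\mathcal{D},\star,\downarrow)$. $\tilde\Xi^n:=2\Pi^\emptyset\in\mathcal{P}_n$ for $n\ge1$, $\tilde\Xi^0$ is the empty permutation, and $\tilde\Xi^q:=\tilde\Xi^{q_1}\star\cdots\star\tilde\Xi^{q_k}$ for $q=q_1.\cdots.q_k$ (the empty permutation if $q$ is the empty word). *)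

(* Defs.v *)
From HB Require Import structures.
From mathcomp Require Import all_boot all_fingroup all_algebra.
From mathcomp Require Import zify.
From mathcomp Require Import finmap.
From mathcomp.multinomials Require Import monalg.
From Stdlib Require Import ClassicalEpsilon.

Set Implicit Arguments.
Unset Strict Implicit.
Unset Printing Implicit Defensive.

Import GRing.Theory.
Local Open Scope ring_scope.

Section LinearExtension.
Variable K : fieldType.

Definition linext (I : choiceType) (V : lmodType K) (h : I -> V)
  (c : {malg K[I]}) : V := \sum_(i <- msupp c) c@_i *: h i.

Definition bilext (I J : choiceType) (V : lmodType K) (h : I -> J -> V)
  (c : {malg K[I]}) (d : {malg K[J]}) : V :=
  linext (fun i => linext (h i) d) c.

(* The coefficients of x in the family e.  They are the expected ones when e
   is linearly independent and x is in the span of e, see coefsK. *)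
Definition coefs (I : choiceType) (V : lmodType K) (e : I -> V) (x : V) :
  {malg K[I]} := epsilon (inhabits 0) (fun c => linext e c = x).

(* The bilinear product on the span of e with e i * e j = e (op i j). *)
Definition spanmul (I : choiceType) (V : lmodType K) (op : I -> I -> I)
  (e : I -> V) (x y : V) : V :=
  bilext (fun i j => e (op i j)) (coefs e x) (coefs e y).

Lemma linextEw (I : choiceType) (V : lmodType K) (h : I -> V) (d : {fset I})
  (c : {malg K[I]}) :
  (msupp c `<=` d)%fset -> linext h c = \sum_(i <- d) c@_i *: h i.
Proof.
move=> sub; rewrite /linext (big_fset_incl _ sub) //.
by move=> i _ /mcoeff_outdom ->; rewrite scale0r.
Qed.

Lemma linext_is_linear (I : choiceType) (V : lmodType K) (h : I -> V) :
  linear (linext h).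
Proof.
move=> a c c'; set d := (msupp (a *: c + c') `|` (msupp c `|` msupp c'))%fset.
rewrite !(@linextEw _ _ _ d) ?fsubsetUl //; last 2 first.
- by rewrite (fsubset_trans (fsubsetUr _ _) (fsubsetUr _ _)).
- by rewrite (fsubset_trans (fsubsetUl _ _) (fsubsetUr _ _)).
rewrite scaler_sumr -big_split; apply: eq_bigr => i _ /=.
by rewrite mcoeffD mcoeffZ scalerDl scalerA.
Qed.

HB.instance Definition _ (I : choiceType) (V : lmodType K) (h : I -> V) :=
  GRing.isLinear.Build K {malg K[I]} V _ (linext h) (linext_is_linear h).

Lemma linextU (I : choiceType) (V : lmodType K) (h : I -> V) i :
  linext h << i >> = h i.
Proof.
rewrite (@linextEw _ _ _ [fset i]%fset) ?msuppU_le //.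
by rewrite big_seq_fset1 mcoeffUU scale1r.
Qed.

Lemma coefsK (I : choiceType) (V : lmodType K) (e : I -> V) :
  injective (linext e) -> cancel (linext e) (coefs e).
Proof.
move=> inj c; apply: inj; rewrite /coefs.
by apply: (epsilon_spec (inhabits 0) (fun c' => linext e c' = linext e c)); exists c.
Qed.

Lemma coefs_free (I : choiceType) (V : lmodType K) (e : I -> V) i :
  injective (linext e) -> coefs e (e i) = << i >>.
Proof. by move=> inj; rewrite -[RHS](coefsK inj) linextU. Qed.

Lemma spanmulE (I : choiceType) (V : lmodType K) (op : I -> I -> I) (e : I -> V) :
  injective (linext e) -> forall i j, spanmul op e (e i) (e j) = e (op i j).
Proof.
by move=> inj i j; rewrite /spanmul !coefs_free // /bilext !linextU.
Qed.

Lemma triangular_free (I J : choiceType) (e : I -> {malg K[J]})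
  (w : I -> J) (m : I -> nat) :
  (forall i, (e i)@_(w i) = 1) ->
  (forall i j, (e j)@_(w i) != 0 -> j = i \/ (m i < m j)%N) ->
  injective (linext e).
Proof.
move=> w1 w0; apply: raddf_inj => c c0; apply/eqP/negPn/negP => cN0.
have /fset0Pn[i0 i0c] : msupp c != fset0.
  apply: contraNneq cN0 => c_0; apply/eqP/malgP => i.
  by rewrite mcoeff0 mcoeff_outdom // c_0.
pose P (k : nat) := has (fun i => m i == k) (msupp c).
have exP : exists k, P k by exists (m i0); apply/hasP; exists i0.
have ubP k : P k -> (k <= \sum_(i <- msupp c) m i)%N.
  by case/hasP => i ic /eqP <-; rewrite (big_rem i) //= leq_addr.
case: (ex_maxnP exP ubP) => k /hasP[i ic /eqP mi] maxk.
have: (linext e c)@_(w i) = 0 by rewrite c0 mcoeff0.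
rewrite /linext (raddf_sum (mcoeff (w i))) /= (big_fsetD1 i) //=.
rewrite big1_seq ?addr0.
  by rewrite mcoeffZ w1 mulr1 => /eqP; rewrite mcoeff_eq0 ic.
move=> j /andP[_]; rewrite in_fsetD1 => /andP[/eqP ji jc].
rewrite mcoeffZ; case: (eqVneq ((e j)@_(w i)) 0) => [->|]; first by rewrite mulr0.
case/w0 => // lt_ij; have: P (m j) by apply/hasP; exists j.
by move/maxk; rewrite leqNgt -mi lt_ij.
Qed.

End LinearExtension.

(* One-line notation, with values and positions numbered from 1: the image of
   i under pi for 1 <= i <= n. *)
Definition img n (pi : 'S_n) (i : nat) : nat :=
  if insub i.-1 is Some k then (pi (k : 'I_n)).+1 else 0.

(* Subsets of {1, ..., n-1} are the A : {set 'I_n} that do not contain 0. *)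
Definition Des n (pi : 'S_n) : {set 'I_n} :=
  [set i : 'I_n | (0 < i) && (img pi i > img pi i.+1)]%N.

Definition Peak n (pi : 'S_n) : {set 'I_n} :=
  [set i : 'I_n | [&& 1 < i, img pi i.-1 < img pi i & img pi i > img pi i.+1]]%N.

Definition composition := {q : seq nat | 0%N \notin q}.

Lemma ccat_subproof (q r : composition) : 0%N \notin val q ++ val r.
Proof. by rewrite mem_cat negb_or (valP q) (valP r). Qed.

Definition ccat (q r : composition) : composition :=
  Sub (val q ++ val r) (ccat_subproof q r).

Definition cnil : composition := Sub [::] isT.

(* The word with the single letter k if k > 0, the empty word if k = 0. *)
Definition letter (k : nat) : composition := insubd cnil [:: k].

(* D(q), for q of sum n: the last partial sum of q is n, which is not in 'I_n. *)
Definition Dcomp n (q : seq nat) : {set 'I_n} :=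
  [set i : 'I_n | (i : nat) \in scanl addn 0%N q].

(* The elements of all the symmetric groups. *)
Definition Sall := {n : nat & 'S_n}.
HB.instance Definition _ := Choice.on Sall.

Definition sall n (pi : 'S_n) : Sall := Tagged (fun m => 'S_m) pi.

Section Algebra.
Variable K : fieldType.

(* KS is the direct sum of the K S_n, n >= 0, and KS2 its tensor square. *)
Local Notation KS := {malg K[Sall]}.
Local Notation KS2 := {malg K[(Sall * Sall)%type]}.

Definition emptyS : KS := << sall (1%g : 'S_0) >>.

Definition Delta n (D : {set 'I_n}) : KS :=
  \sum_(pi : 'S_n | Des pi == D) << sall pi >>.

Definition XiD n (D : {set 'I_n}) : KS :=
  \sum_(E : {set 'I_n} | E \subset D) Delta E.

Definition Xi (q : composition) : KS := XiD (Dcomp (sumn (val q)) (val q)).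

Definition Pi n (P : {set 'I_n}) : KS :=
  \sum_(pi : 'S_n | Peak pi == P) << sall pi >>.

(* The inner product: that of K S_n on each K S_n, and x y = 0 for x in K S_n
   and y in K S_m with n <> m.  In MathComp, (s * t)%g is s followed by t. *)
Definition smul (s t : Sall) : KS :=
  if tag s == tag t then << sall (tagged s * tagged_as s t)%g >> else 0.

Definition inner : KS -> KS -> KS := bilext smul.

(* D_n; Delta D = 0 when D contains 0. *)
Definition inDn (n : nat) (x : KS) : Prop :=
  exists c : {set 'I_n} -> K, x = \sum_D c D *: Delta D.

(* P_n; Pi P = 0 when P contains 0 or 1. *)
Definition inPn (n : nat) (x : KS) : Prop :=
  exists c : {set 'I_n} -> K, x = \sum_P c P *: Pi P.

Definition dsum (V : nat -> KS -> Prop) (x : KS) : Prop :=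
  exists (N : nat) (y : nat -> KS),
    (forall n, V n (y n)) /\ x = \sum_(n < N) y n.

Definition inD : KS -> Prop := dsum inDn.
Definition inP : KS -> Prop := dsum inPn.

Definition tens : KS -> KS -> KS2 := bilext (fun s t => << (s, t) >>).

Definition tensmap (f g : KS -> KS) : KS2 -> KS2 :=
  linext (fun p => tens (f << p.1 >>) (g << p.2 >>)).

(* The values of star and down outside of D, and of star2 outside of
   D (x) D, are irrelevant. *)
Definition star : KS -> KS -> KS := spanmul ccat Xi.

Definition Xi2 (p : composition * composition) : KS2 := tens (Xi p.1) (Xi p.2).

(* (a (x) b) star2 (c (x) d) = (a star c) (x) (b star d) on D (x) D. *)
Definition star2 : KS2 -> KS2 -> KS2 :=
  spanmul (fun p r => (ccat p.1 r.1, ccat p.2 r.2)) Xi2.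

(* The image of Xi^n under the coproduct; down is the extension of down1 to an
   algebra homomorphism, D being free as an algebra on the Xi^n, n > 0. *)
Definition down1 (n : nat) : KS2 :=
  \sum_(k < n.+1) tens (Xi (letter k)) (Xi (letter (n - k))).

Definition down (x : KS) : KS2 :=
  linext (fun q : composition =>
            \big[star2/tens emptyS emptyS]_(a <- val q) down1 a)
         (coefs Xi x).

(* The counit of D: the projection onto D_0, identified with K. *)
Definition counit (x : KS) : K := x@_(sall (1%g : 'S_0)).

Definition tXi (n : nat) : KS :=
  if n is 0 then emptyS else 2%:R *: Pi (set0 : {set 'I_n}).

Definition tXiq (q : composition) : KS := \big[star/emptyS]_(a <- val q) tXi a.

(* Right multiplication with the sum of the tXi n, on all of KS. *)
Definition rmul_tXi : KS -> KS :=
  linext (fun s => inner << s >> (tXi (tag s))).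

Definition left_ideal (A I : KS -> Prop) : Prop :=
  [/\ forall y, I y -> A y,
      I 0,
      forall (a : K) y z, I y -> I z -> I (a *: y + z) &
      forall x y, A x -> I y -> I (inner x y)].

(* That the restriction of f to D is a graded epimorphism of bialgebras from
   (D, star, down) to (P, star, down).  The operations of P are the
   restrictions of those of D. *)
Record graded_bialgebra_epi (f : {linear KS -> KS}) : Prop := {
  gbe_graded : forall n x, inDn n x -> inPn n (f x);
  gbe_onto : forall y, inP y -> exists2 x, inD x & f x = y;
  gbe_mul : forall x y, inD x -> inD y -> f (star x y) = star (f x) (f y);
  gbe_unit : f emptyS = emptyS;
  gbe_comul : forall x, inD x -> down (f x) = tensmap f f (down x);
  gbe_counit : forall x, inD x -> counit (f x) = counit x
}.

HB.instance Definition _ := GRing.Linear.on rmul_tXi.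

Lemma mcoeff_sall n (pi : 'S_n) s :
  (<< sall pi >> : KS)@_s = (sall pi == s)%:R.
Proof. by rewrite mcoeffU. Qed.

Lemma sall_inj n : injective (@sall n).
Proof. by move=> pi sg /eqP; rewrite -tag_eqE /tag_eq /= eqxx /= tagged_asE => /eqP. Qed.

Lemma scanl_gt0 (q : seq nat) a : 0%N \notin q ->
  path ltn a (scanl addn a q).
Proof.
elim: q a => //= b q IHq a; rewrite inE negb_or => /andP[b0 /IHq->].
by rewrite andbT; lia.
Qed.

Lemma Dcomp_gt0 n (q : composition) i : i \in Dcomp n (val q) -> (0 < i)%N.
Proof.
rewrite inE => qi; have /(order_path_min ltn_trans)/allP := scanl_gt0 0 (valP q).
exact.
Qed.

Lemma img_ord n (pi : 'S_n) (i : 'I_n) : img pi i.+1 = (pi i).+1.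
Proof. by rewrite /img /= valK. Qed.

Lemma Des_ex n (D : {set 'I_n}) :
  (forall i, i \in D -> (0 < i)%N) -> exists pi : 'S_n, Des pi == D.
Proof.
case: n D => [|n] D D_gt0.
  exists 1%g; apply/eqP/setP => -[]//.
pose c (i : nat) := #|[set d in D | d <= i]%N|.
pose key (i : 'I_n.+1) := ((n.+1 - c i) * n.+1 + i)%N.
have c_le i : (c i <= n.+1)%N by rewrite -[leqRHS]card_ord max_card.
have key_inj : injective key.
  move=> i j /(congr1 (modn^~ n.+1)); rewrite !modnMDl !modn_small //.
  exact: val_inj.
pose rk i := #|[set j | key j < key i]%N|.
have rk_mono i j : (key i < key j)%N -> (rk i < rk j)%N.
  move=> ij; apply: proper_card; apply/properP; split.
    by apply/subsetP => k; rewrite !inE => /ltn_trans; apply.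
  by exists i; rewrite inE // ltnn.
have rkE i j : (rk i < rk j)%N = (key i < key j)%N.
  case: (ltngtP (key i)) => [/rk_mono//|ji|/key_inj->]; last exact: ltnn.
  by apply/negbTE; rewrite -leqNgt ltnW // rk_mono.
have rk_lt i : (rk i < n.+1)%N.
  rewrite -[ltnRHS]card_ord; apply: proper_card; apply/properP; split.
    exact/subsetP.
  by exists i; rewrite // inE ltnn.
have rk_inj : injective (fun i => Ordinal (rk_lt i)).
  move=> i j /(congr1 val)/= rij; apply: key_inj.
  by case: (ltngtP (key i) (key j)) => // /rk_mono; rewrite rij ltnn.
exists (perm rk_inj); apply/eqP/setP => i; rewrite inE.
case: (posnP i) => [i0|i_gt0] /=.
  by apply/esym/negbTE/negP => /D_gt0; rewrite i0.
have pi_lt : (i.-1 < n.+1)%N by rewrite (leq_ltn_trans (leq_pred _)).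
have imgE pi : img pi i = (pi (Ordinal pi_lt)).+1 by rewrite -img_ord /= prednK.
rewrite img_ord imgE !permE /= ltnS rkE /key /=.
have cE : c i = (c i.-1 + (i \in D))%N.
  rewrite /c (cardD1 i [set d in D | d <= i]%N) addnC inE leqnn andbT.
  congr (_ + _)%N; apply: eq_card => d; rewrite !inE -val_eqE /=.
  by case: (d \in D); rewrite ?andbF //=; lia.
have := c_le i; rewrite {}cE; have := ltn_ord i.
by case: (i \in D) => /=; nia.
Qed.

Lemma Dcomp_inj (q r : composition) : sumn (val q) = sumn (val r) ->
  Dcomp (sumn (val q)) (val q) = Dcomp (sumn (val q)) (val r) -> q = r.
Proof.
move=> qr Dqr; apply: val_inj.
have sc (s : composition) i : (i \in scanl addn 0%N (val s)) =
    (i == sumn (val s)) && (val s != [::]) ||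
    (i < sumn (val s))%N && (i \in scanl addn 0%N (val s)).
  have le (t : seq nat) a : i \in scanl addn a t -> (i <= a + sumn t)%N.
    elim: t a => //= b t IHt a; rewrite inE addnA => /predU1P[->|/IHt //].
    exact: leq_addr.
  have la (t : seq nat) a : t != [::] -> (a + sumn t)%N \in scanl addn a t.
    elim: t a => //= b [|b' t] IHt a _; first by rewrite addn0 inE.
    by rewrite addnA in_cons IHt ?orbT.
  case: ltngtP => [||->] /=; rewrite ?andbF ?orbF //.
    by move=> lt; apply/negbTE/negP => /le; lia.
  have [->|/(la _ 0%N)] := eqVneq (val s) [::] => //.
have nilE (s : composition) : (val s == [::]) = (sumn (val s) == 0%N).
  by case: s => -[|[|a] s].
have E : scanl addn 0%N (val q) = scanl addn 0%N (val r).
  apply: (irr_sorted_eq ltn_trans ltnn).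
  - exact: path_sorted (scanl_gt0 0 (valP q)).
  - exact: path_sorted (scanl_gt0 0 (valP r)).
  move=> i; rewrite sc [RHS]sc !nilE -qr; congr (_ || _).
  case: ltnP => //= i_lt; have /setP/(_ (Ordinal i_lt)) := Dqr.
  by rewrite !inE.
have K' : forall x : nat, cancel (addn x) (fun y => y - x)%N.
  by move=> x y; rewrite addKn.
by rewrite -(scanlK K' 0%N (val q)) E (scanlK K').
Qed.

Lemma XiDE n (D : {set 'I_n}) :
  XiD D = \sum_(pi : 'S_n | Des pi \subset D) << sall pi >> :> KS.
Proof.
rewrite /XiD /Delta (partition_big (@Des n) (fun E => E \subset D)) //=.
apply: eq_bigr => E ED; apply: eq_bigl => pi.
by case: eqP => [->|]; rewrite ?ED ?andbF.
Qed.

Lemma mcoeff_XiD n (D : {set 'I_n}) (pi : 'S_n) :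
  (XiD D : KS)@_(sall pi) = (Des pi \subset D)%:R.
Proof.
rewrite XiDE raddf_sum /=; under eq_bigr do rewrite mcoeff_sall (inj_eq (@sall_inj n)).
case: (boolP (_ \subset _)) => pD.
  rewrite (bigD1 pi) //= eqxx big1 ?addr0 // => i /andP[_ /negPf->] //.
by rewrite big1 // => i iD; case: eqP => // ip; rewrite -ip iD in pD.
Qed.

Lemma mcoeff_XiD_tag n (D : {set 'I_n}) (s : Sall) :
  (XiD D : KS)@_s != 0 -> tag s = n.
Proof.
rewrite XiDE raddf_sum /= => /eqP h; apply/eqP/negPn/negP => sn; apply: h.
apply: big1 => pi _; rewrite mcoeff_sall; case: eqP => // ps.
by rewrite -ps eqxx in sn.
Qed.

Definition Dperm n (D : {set 'I_n}) : 'S_n :=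
  odflt 1%g [pick pi : 'S_n | Des pi == D].

Definition Xiw (q : composition) : Sall := sall (Dperm (Dcomp (sumn (val q)) (val q))).

Definition Xim (q : composition) : nat := #|Dcomp (sumn (val q)) (val q)|.

Lemma Des_Dperm (q : composition) n : Des (Dperm (Dcomp n (val q))) = Dcomp n (val q).
Proof.
rewrite /Dperm; case: pickP => [pi /eqP //|] noD.
by have [pi] := Des_ex (@Dcomp_gt0 n q); rewrite noD.
Qed.

Lemma Xiw_Xi q : (Xi q : KS)@_(Xiw q) = 1.
Proof. by rewrite mcoeff_XiD Des_Dperm subxx. Qed.

Lemma Xiw_neq0 q r : (Xi r : KS)@_(Xiw q) != 0 -> r = q \/ (Xim q < Xim r)%N.
Proof.
move=> qr; have /= sE := mcoeff_XiD_tag qr.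
move: qr; rewrite /Xi /Xim -sE mcoeff_XiD Des_Dperm => qr.
have {qr} sub : Dcomp (sumn (val q)) (val q) \subset Dcomp (sumn (val q)) (val r).
  by apply: contraNT qr => /negPf->.
case: (eqVproper sub) => [/(Dcomp_inj sE)->|/proper_card]; by [left|right].
Qed.

Lemma Xi_free : injective (linext (Xi : composition -> KS)).
Proof. exact: triangular_free Xiw_Xi Xiw_neq0. Qed.

Lemma mcoeff_tens (x y : KS) p : (tens x y)@_p = x@_p.1 * y@_p.2.
Proof.
case: p => s t; rewrite /tens /bilext.
have E (I : choiceType) (h : I -> KS2) c : (linext h c)@_(s, t) =
    \sum_(i <- msupp c) c@_i * (h i)@_(s, t).
  by rewrite /linext raddf_sum /=; apply: eq_bigr => i _; rewrite mcoeffZ.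
have S (c : KS) u : \sum_(i <- msupp c) c@_i * (i == u)%:R = c@_u.
  case: (boolP (u \in msupp c)) => uc.
    rewrite (big_fsetD1 u) //= eqxx mulr1 big1_seq ?addr0 // => i /andP[_].
    by rewrite in_fsetD1 => /andP[/negPf-> _]; rewrite mulr0.
  rewrite mcoeff_outdom // big1_seq // => i /andP[_ ic].
  by case: eqP => [iu|]; rewrite ?mulr0 // -iu ic in uc *.
rewrite E -(S x s) mulr_suml; apply: eq_bigr => i _; rewrite E -mulrA.
congr (_ * _); rewrite -(S y t) mulr_sumr; apply: eq_bigr => j _.
by rewrite mcoeffU xpair_eqE mulrCA -natrM mulnb.
Qed.

Lemma Xi2_free : injective (linext (Xi2 : _ -> KS2)).
Proof.
apply: (@triangular_free _ _ _ _ (fun p => (Xiw p.1, Xiw p.2))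
                         (fun p => Xim p.1 + Xim p.2)%N).
  by move=> p; rewrite mcoeff_tens !Xiw_Xi mulr1.
move=> [p1 p2] [r1 r2] /=; rewrite mcoeff_tens mulf_eq0 negb_or => /andP[].
by case/Xiw_neq0 => /= [->|?] /Xiw_neq0[->|?] /=; [left|right; lia..].
Qed.

Lemma star_Xi q r : star (Xi q) (Xi r) = Xi (ccat q r) :> KS.
Proof. exact: spanmulE Xi_free _ _. Qed.

Lemma star2_Xi p r : star2 (Xi2 p) (Xi2 r) =
  tens (star (Xi p.1) (Xi r.1)) (star (Xi p.2) (Xi r.2)) :> KS2.
Proof.
apply: etrans (spanmulE _ Xi2_free p r) _.
by congr (tens _ _); apply/esym/star_Xi.
Qed.

Lemma down_Xi (q : composition) :
  down (Xi q) = \big[star2/tens emptyS emptyS]_(a <- val q) down1 a.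
Proof. by rewrite /down (coefs_free _ Xi_free) linextU. Qed.

End Algebra.

(* Main.v *)
(** Let T be the right multiplication by the sum of the tXi^n. The coefficient
    of tXi^n at a permutation s is the number of ways of putting signs on the
    letters of s so that the signed word increases. Hence the coefficient of
    T x at w is the sum, over all signings of the letters of w, of the
    coefficient of x at the standardization of the signed word. For x = Xi^D
    every position i outside of D constrains the signing by forcing exactly one
    sign, and two constraints conflict only at a peak p of w with p and p - 1
    outside of D. So T (Xi^D) is a power of 2 times the sum of the Pi^P with P
    contained in the union of D and D + 1. This is triangular in D = P, which gives the
    image of T; it factorizes over the blocks of q, which gives
    T (Xi^q) = tXi^q because star is dual to the deconcatenation of words.
    Finally tXi(z) = Xi(-z)^-1 star Xi(z) for the generating series, so that
    tXi is group-like and T commutes with down, and P_n is a left ideal since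
    D_n is closed under the inner product (Solomon), by the same counting with
    block numbers in place of signs. *)

Require Import Defs.
From HB Require Import structures.
From mathcomp Require Import all_boot all_fingroup all_algebra.
From mathcomp Require Import zify.
From mathcomp Require Import finmap.
From mathcomp.multinomials Require Import monalg.
Set Implicit Arguments.
Unset Strict Implicit.
Unset Printing Implicit Defensive.

Import GRing.Theory.
Local Open Scope ring_scope.

(** * Linear extension over monoid algebras *)

Lemma scaler_exchange (R : comNzRingType) (V : lmodType R) (a b : R) (x y z t : V) :
  b *: (a *: x + y) + (a *: z + t) = a *: (b *: x + z) + (b *: y + t).
Proof. by rewrite !scalerDr !scalerA (mulrC b a) addrACA. Qed.

Lemma malg_ind (K : fieldType) (I : choiceType) (P : {malg K[I]} -> Prop) :
  P 0 -> (forall a i c, P c -> P (a *: << i >> + c)) -> forall c, P c.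
Proof.
move=> P0 PD c; rewrite [c]monalgE.
elim: (enum_fset (msupp c)) => [|i s IHs]; first by rewrite big_nil.
rewrite big_cons; have -> : << c@_i *g i >> = c@_i *: << i >> :> {malg K[I]}.
  by apply/malgP => j; rewrite mcoeffZ !mcoeffU mulrnAr mulr1.
exact: PD.
Qed.

Lemma malg_scalerAr (K : fieldType) (M : monomType) (a : K)
  (x y : {malg K[M]}) : x * (a *: y) = a *: (x * y).
Proof.
apply/malgP => k; rewrite mcoeffZ (mcoeffMlw _ (fsubset_refl _) (msuppZ_le _ _)).
rewrite mcoeffMl mulr_sumr; apply: eq_bigr => i _; rewrite mulr_sumr.
by apply: eq_bigr => j _; rewrite mcoeffZ mulrnAr mulrCA.
Qed.

Lemma malg_mulU (K : fieldType) (M : monomType) (m n : M) :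
  << m >> * << n >> = << mmul m n >> :> {malg K[M]}.
Proof. by rewrite malgM_def fgmulUU mulr1. Qed.

Lemma linextM (K : fieldType) (M N : monomType) (h : M -> {malg K[N]}) :
  (forall m n, h (mmul m n) = h m * h n) ->
  {morph linext h : x y / x * y}.
Proof.
move=> hM x y.
have hMU m : linext h (<< m >> * y) = h m * linext h y.
  elim/malg_ind: y => [|b n y IHy]; first by rewrite mulr0 linear0 mulr0.
  rewrite mulrDr malg_scalerAr malg_mulU !linearD !linearZ /= IHy !linextU.
  by rewrite hM mulrDr malg_scalerAr.
elim/malg_ind: x => [|a m x IHx]; first by rewrite mul0r linear0 mul0r.
by rewrite mulrDl -scalerAl !linearD !linearZ /= IHx hMU mulrDl -scalerAl linextU.
Qed.

(** A bilinear extension that sees its two indices only through their product factors through the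
    multiplication of the monoid algebra. This is what turns [spanmul] into a ring product. *)
Lemma bilext_linext (K : fieldType) (M : monomType) (V : lmodType K)
  (h : M -> V) (c d : {malg K[M]}) :
  bilext (fun i j => h (mmul i j)) c d = linext h (c * d).
Proof.
have hU m : linext (fun j => h (mmul m j)) d = linext h (<< m >> * d).
  elim/malg_ind: d => [|b n d IHd]; first by rewrite mulr0 !linear0.
  rewrite mulrDr malg_scalerAr malg_mulU !linearD !linearZ /= IHd.
  by rewrite !linextU.
rewrite /bilext; elim/malg_ind: c => [|a m c IHc]; first by rewrite mul0r !linear0.
by rewrite mulrDl -scalerAl !linearD !linearZ /= IHc linextU hU.
Qed.

(** * Compositions as a monoid, and products of monoids *)

Lemma ccatA : associative ccat.
Proof. by move=> p q r; apply: val_inj; rewrite /= catA. Qed.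

Lemma ccat0q : left_id cnil ccat.
Proof. by move=> q; apply: val_inj. Qed.

Lemma ccatq0 : right_id cnil ccat.
Proof. by move=> q; apply: val_inj; rewrite /= cats0. Qed.

Lemma ccat_nil p q : ccat p q = cnil -> p = cnil /\ q = cnil.
Proof.
move=> /(congr1 val) /= /eqP; rewrite -size_eq0 size_cat addn_eq0 !size_eq0.
by case/andP=> /eqP p0 /eqP q0; split; apply: val_inj.
Qed.

(** With this structure [{malg K[composition]}] is the free associative algebra on the positive
    integers. It serves as a model of $\mathcal{D}$ through [linext Xi]. *)
HB.instance Definition _ := Choice.on composition.
HB.instance Definition _ := Choice_isMonomialDef.Build composition
  ccatA ccat0q ccatq0 ccat_nil.

Section ProdMonom.
Variables M N : monomType.
Implicit Types x y : M * N.

Definition pmul x y : M * N := (mmul x.1 y.1, mmul x.2 y.2).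

Lemma pmulA : associative pmul.
Proof. by move=> x y z; rewrite /pmul /= !mulmA. Qed.

Lemma pmul1m : left_id (mone, mone) pmul.
Proof. by move=> [x y]; rewrite /pmul /= !mul1m. Qed.

Lemma pmulm1 : right_id (mone, mone) pmul.
Proof. by move=> [x y]; rewrite /pmul /= !mulm1. Qed.

Lemma pmul_unit x y : pmul x y = (mone, mone) -> x = (mone, mone) /\ y =
  (mone, mone).
Proof.
by case: x y => [x1 x2] [y1 y2] /pair_equal_spec[/unitm[/= -> ->] /unitm[/= -> ->]].
Qed.

HB.instance Definition _ := Choice.on (M * N)%type.
HB.instance Definition _ := Choice_isMonomialDef.Build (M * N)%type
  pmulA pmul1m pmulm1 pmul_unit.
End ProdMonom.

(** * The products [star] and [star2] in the free model *)

Section StarProduct.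
Variable K : fieldType.
Local Notation A := {malg K[composition]}.
Local Notation A2 := {malg K[(composition * composition)%type]}.
Local Notation L := (linext (@Xi K)).
Local Notation L2 := (linext (@Xi2 K)).

(** The [Xi q] are linearly independent, so [coefs] recovers [c] and [d] exactly; [linext Xi]
    therefore carries the product of the free algebra to [star]. *)
Lemma star_linext (c d : A) : star (L c) (L d) = L (c * d).
Proof.
rewrite /star /spanmul !(coefsK (@Xi_free K)).
exact: (@bilext_linext K composition _ (@Xi K) c d).
Qed.

Lemma star2_linext (c d : A2) : star2 (L2 c) (L2 d) = L2 (c * d).
Proof.
rewrite /star2 /spanmul !(coefsK (@Xi2_free K)).
exact: (@bilext_linext K (composition * composition)%type _ (@Xi2 K) c d).
Qed.

End StarProduct.

(** * Standardization, descents and peaks *)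

(* The standardization of f 0, ..., f (n - 1), equal letters being ranked from
   left to right. *)
Section Std.
Variables (n : nat) (f : nat -> nat).
Let key (i : 'I_n) := (f i * n + i)%N.
Let rk (i : 'I_n) := #|[set j | key j < key i]%N|.

Let rk_lt i : (rk i < n)%N.
Proof.
rewrite -[ltnRHS]card_ord; apply: proper_card; apply/properP; split.
  exact/subsetP.
by exists i; rewrite // inE ltnn.
Qed.

Let rk_mono i j : (key i < key j)%N -> (rk i < rk j)%N.
Proof.
move=> ij; apply: proper_card; apply/properP; split.
  by apply/subsetP => k; rewrite !inE => /ltn_trans; apply.
by exists i; rewrite inE // ltnn.
Qed.

Let key_inj : injective key.
Proof.
move=> i j /(congr1 (modn^~ n)); rewrite !modnMDl !modn_small //.
exact: val_inj.
Qed.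

Let rk_inj : injective (fun i => Ordinal (rk_lt i)).
Proof.
move=> i j /(congr1 val)/= rij; apply: key_inj.
by case: (ltngtP (key i) (key j)) => // /rk_mono; rewrite rij ltnn.
Qed.

Definition std : 'S_n := perm rk_inj.

Lemma std_lt (i j : 'I_n) : (i < j)%N -> (std i < std j)%N = (f i <= f j)%N.
Proof.
move=> ij; rewrite !permE /=.
have -> : (rk i < rk j)%N = (key i < key j)%N.
  case: (ltngtP (key i)) => [/rk_mono//|ji|/key_inj->]; last exact: ltnn.
  by apply/negbTE; rewrite -leqNgt ltnW // rk_mono.
have := ltn_ord j; have := ltn_ord i; rewrite /key.
by case: (leqP (f i) (f j)); nia.
Qed.

Lemma std_gt (i j : 'I_n) : (i < j)%N -> (std j < std i)%N = (f j < f i)%N.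
Proof.
move=> ij; rewrite [RHS]ltnNge -std_lt //.
by case: ltngtP => // /ord_inj/perm_inj ji; rewrite ji ltnn in ij.
Qed.
End Std.

(** Each value of a permutation is the number of values below it, so the relative order of the
    values determines them. *)
Lemma perm_lt_inj n (s t : 'S_n) :
  (forall i j : 'I_n, (i < j)%N -> (s i < s j)%N = (t i < t j)%N) -> s = t.
Proof.
move=> st.
have lt_st i j : (s i < s j)%N = (t i < t j)%N.
  case: (ltngtP i j) => [/st//|ji|/val_inj->]; last by rewrite !ltnn.
  have neq (u : 'S_n) : (u i < u j)%N = ~~ (u j < u i)%N.
    by case: ltngtP => // /ord_inj/perm_inj e; rewrite e ltnn in ji.
  by rewrite !neq (st _ _ ji).
have card_lt (u : 'S_n) i : #|[set j | u j < u i]%N| = u i.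
  have -> : [set j | u j < u i]%N = u @^-1: [set k : 'I_n | (k < u i)%N].
    by apply/setP => j; rewrite !inE.
  rewrite card_preimset; last exact: perm_inj.
  have ui := ltnW (ltn_ord (u i)).
  have -> : [set k : 'I_n | (k < u i)%N] = [set widen_ord ui k | k : 'I_(u i)].
    apply/setP => k; rewrite inE; apply/idP/imsetP => [ki|[k' _ ->]] /=.
      by exists (Ordinal ki) => //; apply: val_inj.
    exact: ltn_ord.
  by rewrite card_imset ?card_ord // => j k /(congr1 val) /= /val_inj.
apply/permP => i; apply: val_inj; rewrite /= -card_lt -[RHS]card_lt.
by apply: eq_card => j; rewrite !inE lt_st.
Qed.

(** [Des] numbers positions from 1 and ordinals count from 0: a descent at [i] compares the ordinals
    [i - 1] and [i]. *)
Lemma mem_Des n (s : 'S_n) (i j : 'I_n) : j.+1 = i -> (i \in Des s) = (s i < s j)%N.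
Proof. by move=> ji; rewrite inE -{1 3}ji !img_ord /= ltnS. Qed.

Lemma Des_gt0 n (s : 'S_n) (i : 'I_n) : i \in Des s -> (0 < i)%N.
Proof. by rewrite inE => /andP[]. Qed.

(** A peak is an ascent followed by a descent; by injectivity of [s] an ascent is a non-descent,
    except at 0, where a non-descent says nothing. *)
Lemma mem_Peak n (s : 'S_n) (i j : 'I_n) : j.+1 = i ->
  (i \in Peak s) = [&& 0 < j, j \notin Des s & i \in Des s]%N.
Proof.
move=> ji; have ij : i.-1 = j by rewrite -ji.
rewrite !inE ij ji; have -> : (1 < i)%N = (0 < j)%N by rewrite -ji.
have -> : (0 < i)%N by rewrite -ji.
case: posnP => //= j0; rewrite -leqNgt [in RHS]leq_eqVlt.
have j1 : (j.-1 < n)%N by rewrite (leq_ltn_trans (leq_pred _)).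
have -> : img s j = (s (Ordinal j1)).+1 by rewrite -img_ord /= prednK.
rewrite -[in img s i]ji img_ord eqSS (inj_eq (@ord_inj n)) (inj_eq perm_inj).
by rewrite -val_eqE /= [_ == _](_ : _ = false) //; lia.
Qed.

Lemma Peak_gt1 n (s : 'S_n) (i : 'I_n) : i \in Peak s -> (1 < i)%N.
Proof. by rewrite inE => /and3P[]. Qed.

Lemma Des_std n f (i : 'I_n) :
  (i \in Des (std n f)) = (0 < i)%N && (f i < f i.-1)%N.
Proof.
case: (posnP i) => [i0|i0] /=; first by rewrite inE i0.
have i1 : (i.-1 < n)%N by rewrite (leq_ltn_trans (leq_pred _)).
by rewrite (@mem_Des _ _ i (Ordinal i1)) ?std_gt //= ?prednK.
Qed.

Definition word n (s : 'S_n) : seq nat := [seq (s i : nat) | i <- enum 'I_n].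

Lemma size_word n (s : 'S_n) : size (word s) = n.
Proof. by rewrite size_map size_enum_ord. Qed.

Lemma nth_word n (s : 'S_n) (i : 'I_n) : nth 0%N (word s) i = s i.
Proof. by rewrite (nth_map i) ?size_enum_ord // nth_ord_enum. Qed.

Lemma std_word n (s : 'S_n) : std n (nth 0%N (word s)) = s.
Proof.
apply: perm_lt_inj => i j ij; rewrite std_lt // !nth_word leq_eqVlt.
by rewrite (inj_eq (@ord_inj n)) (inj_eq perm_inj) -val_eqE /= ltn_eqF.
Qed.

(** * Coefficients at arbitrary words *)

Section Words.
Variable K : fieldType.
Local Notation KS := {malg K[Sall]}.

(* x is extended to all words through standardization, so that the product star
   becomes the deconcatenation formula of wcoeff_mul. *)
Definition wcoeff (x : KS) (v : seq nat) : K :=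
  x@_(sall (std (size v) (nth 0%N v))).

Lemma wcoeff_word n (s : 'S_n) x : wcoeff x (word s) = x@_(sall s).
Proof. by rewrite /wcoeff size_word std_word. Qed.

Lemma wcoeff_inj x y : wcoeff x =1 wcoeff y -> x = y.
Proof.
by move=> xy; apply/malgP => -[n s]; rewrite -[existT _ n s]/(sall s) -!wcoeff_word.
Qed.

Lemma wcoeffP a x y v : wcoeff (a *: x + y) v = a * wcoeff x v + wcoeff y v.
Proof. by rewrite /wcoeff mcoeffD mcoeffZ. Qed.

Lemma wcoeff0 v : wcoeff 0 v = 0.
Proof. exact: mcoeff0. Qed.
End Words.

(** * Partial sums and the blocks that they delimit *)

Lemma mem_scanlD a (q : seq nat) i :
  (i \in scanl addn a q) = (a <= i)%N && ((i - a)%N \in scanl addn 0%N q).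
Proof.
elim: q a i => [|b q IHq] a i /=; first by rewrite !inE andbF.
rewrite !inE IHq [in RHS]IHq add0n.
case: (leqP a i) => ai /=; first by rewrite -subnDA; congr (_ || _ && _); lia.
by rewrite leqNgt (leq_trans ai) ?leq_addr // orbF; lia.
Qed.

Lemma mem_scanl_le (q : seq nat) i : i \in scanl addn 0%N q -> (i <= sumn q)%N.
Proof.
elim: q i => //= b q IHq i; rewrite inE mem_scanlD add0n => /predU1P[->|].
  exact: leq_addr.
by case/andP=> bi /IHq; lia.
Qed.

Lemma sumn_scanl (q : seq nat) : q != [::] -> sumn q \in scanl addn 0%N q.
Proof.
elim: q => //= b [|c q] IHq _; first by rewrite addn0 add0n mem_head.
rewrite add0n inE mem_scanlD leq_addr addKn.
by rewrite [X in _ || X](IHq _) ?orbT.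
Qed.

Lemma mem_scanl_cat (p q : seq nat) i : 0%N \notin q -> (0 < i)%N ->
  (i \in scanl addn 0%N (p ++ q)) =
  if (i < sumn p)%N then i \in scanl addn 0%N p
  else (i == sumn p) || ((i - sumn p)%N \in scanl addn 0%N q).
Proof.
move=> q0 i0; rewrite scanl_cat mem_cat.
have foldl_addn a : foldl addn a p = (a + sumn p)%N.
  by elim: p a => [|b p IHp] a /=; rewrite ?addn0 // IHp addnA.
rewrite foldl_addn add0n.
rewrite (mem_scanlD (sumn p)); case: ltngtP => [ip|ip|ip] /=.
- by rewrite orbF.
- by case: (boolP (i \in _)) => // /mem_scanl_le; rewrite leqNgt ip.
(* [scanl] omits the starting value, so an empty [p] has no partial sum equal to [sumn p]; in that
   case [i] would be 0. *)
rewrite {1}ip sumn_scanl //; case: (p) ip => // ip; by rewrite ip in i0.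
Qed.

(* The blocks of v are delimited by the partial sums of q; in peakless_blocks
   the peak is at i.-1, counted from 0. *)
Definition sorted_blocks (q v : seq nat) : bool :=
  [forall i : 'I_(size v), [|| i == 0 :> nat, (i : nat) \in scanl addn 0 q
                             | nth 0 v i.-1 <= nth 0 v i]%N].

Definition peakless_blocks (q v : seq nat) : bool :=
  [forall i : 'I_(size v),
     [&& 1 < i, nth 0 v i.-2 <= nth 0 v i.-1 & nth 0 v i < nth 0 v i.-1]%N ==>
     ((i : nat) \in scanl addn 0%N q) || (i.-1 \in scanl addn 0%N q)].

Lemma sorted_blocksP q v : reflect
  (forall i, (0 < i < size v)%N -> i \notin scanl addn 0%N q ->
     (nth 0 v i.-1 <= nth 0 v i)%N)
  (sorted_blocks q v).
Proof.
apply: (iffP forallP) => h => [i /andP[i0 iv] iq|i].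
  by have := h (Ordinal iv); rewrite /= (gtn_eqF i0) (negPf iq).
case: posnP => //= i0; case: (boolP (_ \in _)) => //= iq.
by apply: h => //; rewrite i0 ltn_ord.
Qed.

Lemma peakless_blocksP q v : reflect
  (forall i, (1 < i < size v)%N -> (nth 0 v i.-2 <= nth 0 v i.-1)%N ->
     (nth 0 v i < nth 0 v i.-1)%N ->
     (i \in scanl addn 0%N q) || (i.-1 \in scanl addn 0%N q))
  (peakless_blocks q v).
Proof.
apply: (iffP forallP) => h => [i /andP[i1 iv] v1 v2|i].
  by have := h (Ordinal iv); rewrite /= i1 v1 v2.
by apply/implyP => /and3P[i1 v1 v2]; apply: h => //; rewrite i1 ltn_ord.
Qed.

(** The position [sumn p] is a cut, so no condition compares a letter of the first factor with one
    of the second. *)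
Lemma sorted_blocks_cat p q v : 0%N \notin q -> (sumn p <= size v)%N ->
  sorted_blocks (p ++ q) v =
    sorted_blocks p (take (sumn p) v) && sorted_blocks q (drop (sumn p) v).
Proof.
move=> q0; set k := sumn p => kv;
  apply/sorted_blocksP/andP => [h|[/sorted_blocksP h1 /sorted_blocksP h2] i].
  split; apply/sorted_blocksP => i;
    rewrite ?size_takel ?size_drop // => /andP[i0 iv] iq.
    rewrite !nth_take ?(leq_ltn_trans (leq_pred _)) //; apply: h.
      by rewrite i0 (leq_trans iv).
    by rewrite mem_scanl_cat // iv.
  rewrite !nth_drop; have -> : (k + i.-1 = (k + i).-1)%N by lia.
  apply: h; first by lia.
  rewrite mem_scanl_cat //; last by lia.
  by rewrite ltnNge leq_addr /= addKn negb_or iq andbT; lia.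
move=> /andP[i0 iv]; rewrite mem_scanl_cat // -/k; case: ltnP => ik.
  have := h1 i; rewrite size_takel // i0 ik => /(_ isT) + iq => /(_ iq).
  by rewrite !nth_take // (leq_ltn_trans (leq_pred _)).
rewrite negb_or => /andP[ik' iq].
have := h2 (i - k)%N; rewrite size_drop !nth_drop => h; move: (h ltac:(lia) iq).
by congr (nth _ _ _ <= nth _ _ _)%N; lia.
Qed.

(** The triples of positions [i - 2, i - 1, i] that straddle the cut at [a] are those with [i = a]
    or [i = a + 1], and both are exempt. The remaining triples lie on one side of the cut. *)
Lemma peakless_blocks_cons a q v : 0%N \notin (a :: q) -> (a <= size v)%N ->
  peakless_blocks (a :: q) v =
    peakless_blocks [::] (take a v) && peakless_blocks q (drop a v).
Proof.
rewrite inE negb_or => /andP[a0 q0] av; have E i : (0 < i)%N ->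
  (i \in scanl addn 0%N (a :: q)) =
  (a <= i)%N && ((i == a) || ((i - a)%N \in scanl addn 0%N q)).
  move=> i0; rewrite -cat1s mem_scanl_cat //= addn0 inE add0n.
  by case: ltngtP.
apply/peakless_blocksP/andP => [h|[/peakless_blocksP h1 /peakless_blocksP h2] i].
  split; apply/peakless_blocksP => i;
    rewrite ?size_takel ?size_drop // => /andP[i1 iv].
    rewrite !nth_take; [|lia..] => v1 v2.
    by have := h i; rewrite !E; [move=> /(_ ltac:(lia) v1 v2); lia|lia..].
  rewrite !nth_drop => v1 v2; have := h (a + i)%N; rewrite !E; [|lia..].
  have e1 : ((a + i).-1 = a + i.-1)%N by lia.
  have e2 : ((a + i.-1).-1 = a + i.-2)%N by lia.
  rewrite e1 e2 !addKn => /(_ ltac:(lia) v1 v2).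
  by case: (i \in _); case: (i.-1 \in _) => //=; lia.
move=> /andP[i1 iv] v1 v2; rewrite !E; [|lia..].
case: (ltngtP i a) => [ia|ia|->] /=; last by [].
  have := h1 i; rewrite size_takel // !nth_take; [|lia..].
  by move=> /(_ ltac:(lia) v1 v2).
case: (eqVneq i.-1 a) => [ia'|ia']; first by rewrite ia' leqnn orbT.
have := h2 (i - a)%N; rewrite size_drop !nth_drop.
have e1 : (a + (i - a).-1 = i.-1)%N by lia.
have e2 : (a + (i - a).-2 = i.-2)%N by lia.
have e3 : (a + (i - a) = i)%N by lia.
rewrite e1 e2 e3 => /(_ ltac:(lia) v1 v2).
have -> : (i.-1 - a = (i - a).-1)%N by lia.
by case/orP => ->; rewrite ?orbT // ltnW //; lia.
Qed.

(** * The product [star] as deconcatenation of words *)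

Section WordCoefficients.
Variable K : fieldType.
Local Notation KS := {malg K[Sall]}.
Local Notation A := {malg K[composition]}.
Local Notation L := (linext (@Xi K)).

Lemma wcoeff_Xi (q : composition) v :
  wcoeff (Xi K q) v = ((size v == sumn (val q)) && sorted_blocks (val q) v)%:R.
Proof.
rewrite /wcoeff; case: eqP => [vq|/eqP vq] /=; last first.
  apply/eqP; apply: contraNT vq => /mcoeff_XiD_tag /= ->; exact: eqxx.
rewrite /Xi -vq mcoeff_XiD; congr (nat_of_bool _)%:R.
apply/subsetP/sorted_blocksP => [h i /andP[i0 iv] iq|h i].
  have := h (Ordinal iv); rewrite Des_std inE /= i0 /= => h'.
  by rewrite leqNgt; apply: contra h' iq.
rewrite Des_std inE => /andP[i0]; apply: contraLR => iq; rewrite -leqNgt.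
by apply: h => //; rewrite i0 ltn_ord.
Qed.

(** Only [k = sumn p] contributes, since [Xi p] vanishes at words of any other length. *)
Lemma wcoeff_ccat p r v : wcoeff (Xi K (ccat p r)) v =
  \sum_(k < (size v).+1) wcoeff (Xi K p) (take k v) * wcoeff (Xi K r) (drop k v).
Proof.
rewrite wcoeff_Xi /= sumn_cat.
have [pv|pv] := leqP (sumn (val p)) (size v); last first.
  have -> : (size v == sumn (val p) + sumn (val r))%N = false by lia.
  rewrite big1 // => k _; rewrite !wcoeff_Xi.
  have kv : (k <= size v)%N by rewrite -ltnS.
  have -> : (size (take k v) == sumn (val p)) = false by rewrite size_takel //; lia.
  by rewrite mul0r.
rewrite (bigD1 (Ordinal (pv : (_ < _.+1)%N))) //= big1 ?addr0 => [|k kp].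
  rewrite !wcoeff_Xi size_takel // eqxx size_drop /= sorted_blocks_cat //;
    last exact: (valP r).
  have -> : (size v - sumn (val p) == sumn (val r))%N =
            (size v == sumn (val p) + sumn (val r))%N by lia.
  by rewrite -natrM mulnb andbCA.
rewrite !wcoeff_Xi size_takel -1?ltnS //.
by move: kp; rewrite -val_eqE /= => /negPf->; rewrite mul0r.
Qed.

Lemma wcoeff_linextM (M : monomType) (h : M -> KS) :
  (forall p r v, wcoeff (h (mmul p r)) v =
     \sum_(k < (size v).+1) wcoeff (h p) (take k v) * wcoeff (h r) (drop k v)) ->
  forall c d v, wcoeff (linext h (c * d)) v =
     \sum_(k < (size v).+1)
        wcoeff (linext h c) (take k v) * wcoeff (linext h d) (drop k v).
Proof.
move=> hM c d v.
have hU p : wcoeff (linext h (<< p >> * d)) v =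
    \sum_(k < (size v).+1) wcoeff (h p) (take k v) * wcoeff (linext h d) (drop k v).
  elim/malg_ind: d => [|b r d IHd].
    by rewrite mulr0 linear0 wcoeff0 big1 // => k _; rewrite wcoeff0 mulr0.
  rewrite mulrDr malg_scalerAr malg_mulU linearD linearZ /= linextU wcoeffP IHd hM.
  rewrite mulr_sumr -big_split; apply: eq_bigr => k _ /=.
  by rewrite linearD linearZ /= linextU wcoeffP mulrDr mulrCA.
elim/malg_ind: c => [|a p c IHc].
  by rewrite mul0r linear0 wcoeff0 big1 // => k _; rewrite wcoeff0 mul0r.
rewrite mulrDl -scalerAl linearD linearZ /= wcoeffP IHc hU mulr_sumr -big_split.
apply: eq_bigr => k _ /=.
by rewrite linearD linearZ /= linextU wcoeffP mulrDl mulrA.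
Qed.

Lemma wcoeff_mul (c d : A) v : wcoeff (L (c * d)) v =
  \sum_(k < (size v).+1) wcoeff (L c) (take k v) * wcoeff (L d) (drop k v).
Proof. exact: (wcoeff_linextM wcoeff_ccat). Qed.
End WordCoefficients.

(** * The inner product and functions constant on classes *)

Section Inner.
Variable K : fieldType.
Local Notation KS := {malg K[Sall]}.

Lemma sall_eq n (s t : 'S_n) : (sall s == sall t) = (s == t).
Proof. exact: (inj_eq (@sall_inj n)). Qed.

Lemma sall_neq m n (s : 'S_m) (t : 'S_n) : m != n -> (sall s == sall t) = false.
Proof. by move=> mn; apply/eqP => /(congr1 tag) /= /eqP; rewrite (negPf mn). Qed.

Lemma sall_tag n (s : Sall) : tag s = n -> exists p : 'S_n, s = sall p.
Proof. by case: s => m p /= mn; case: _ / mn; exists p. Qed.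

Lemma inner_linearl a (x y z : KS) : inner (a *: x + y) z =
  a *: inner x z + inner y z.
Proof. by rewrite /inner /bilext linearP. Qed.

Lemma inner0l (z : KS) : inner 0 z = 0.
Proof. by rewrite /inner /bilext linear0. Qed.

(** A sum with at most one nonzero term: in this form the bilinear extension to [mcoeff_inner] is
    termwise. *)
Lemma mcoeff_smul n (w : 'S_n) (s t : Sall) : (smul K s t)@_(sall w) =
  \sum_(p : 'S_n) (s == sall p)%:R * (t == sall (p^-1 * w))%:R.
Proof.
case: s => m s; rewrite -[existT _ m s]/(sall s).
have [mn|mn] := eqVneq m n; last first.
  rewrite big1 => [|p _]; last first.
    by rewrite sall_neq // mul0r.
  rewrite /smul; case: ifP => _; last exact: mcoeff0.
  by rewrite mcoeffU sall_neq.
case: _ / mn w => w; rewrite (bigD1 s) //= big1 ?addr0 => [|p ps]; last first.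
  by rewrite sall_eq eq_sym (negPf ps) mul0r.
rewrite eqxx mul1r /smul /=; case: t => k t; rewrite -[existT _ k t]/(sall t) /=.
have [mk|mk] := eqVneq m k; last first.
  by rewrite mcoeff0 sall_neq // eq_sym.
case: _ / mk t => t; rewrite tagged_asE mcoeff_sall !sall_eq.
congr (nat_of_bool _)%:R; apply/eqP/eqP => [<-|->]; first by rewrite mulKg.
by rewrite mulKVg.
Qed.

Lemma mcoeff_inner n (x y : KS) (w : 'S_n) : (inner x y)@_(sall w) =
  \sum_(p : 'S_n) x@_(sall p) * y@_(sall (p^-1 * w)).
Proof.
elim/malg_ind: x => [|a s x IHx].
  by rewrite inner0l mcoeff0 big1 // => p _; rewrite mcoeff0 mul0r.
rewrite inner_linearl mcoeffD mcoeffZ IHx.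
under [RHS]eq_bigr do rewrite mcoeffD mcoeffZ mulrDl.
rewrite big_split /=; congr (_ + _); rewrite {x IHx}.
rewrite /inner /bilext linextU; elim/malg_ind: y => [|b t y IHy].
  by rewrite linear0 mcoeff0 mulr0 big1 // => p _; rewrite mcoeff0 mulr0.
rewrite linearD linearZ /= mcoeffD mcoeffZ mulrDr IHy linextU mcoeff_smul.
under [RHS]eq_bigr do rewrite mcoeffD mcoeffZ mulrDr.
rewrite big_split /=; congr (_ + _); rewrite !mulr_sumr.
by apply: eq_bigr => p _; rewrite !mcoeffU; rewrite !mulrA; congr (_ * _);
  rewrite mulrAC.
Qed.

Lemma mcoeff_rmul n (x : KS) (w : 'S_n) : (rmul_tXi x)@_(sall w) =
  \sum_(p : 'S_n) x@_(sall p) * (tXi K n)@_(sall (p^-1 * w)).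
Proof.
rewrite /rmul_tXi; elim/malg_ind: x => [|a s x IHx].
  by rewrite linear0 mcoeff0 big1 // => p _; rewrite mcoeff0 mul0r.
rewrite linearD linearZ /= mcoeffD mcoeffZ IHx linextU mcoeff_inner.
under [RHS]eq_bigr do rewrite mcoeffD mcoeffZ mulrDl.
rewrite big_split /=; congr (_ + _); rewrite mulr_sumr.
apply: eq_bigr => p _; rewrite -mulrA; congr (_ * _).
rewrite mcoeffU; case: eqP => [->|] //=; by rewrite !mul0r.
Qed.

(** A description of $\mathcal{D}_n$ (with [cl] equal to [Des]) and of $\mathcal{P}_n$ (with [Peak])
    by conditions on coefficients, without chosen scalars. *)
Definition classfun n (J : finType) (cl : 'S_n -> J) (x : KS) :=
  (forall s, tag s != n -> x@_s = 0) /\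
  (forall w w', cl w = cl w' -> x@_(sall w) = x@_(sall w')).

Lemma mcoeff_sum_sall n (P : pred 'S_n) (w : 'S_n) :
  (\sum_(p | P p) << sall p >> : KS)@_(sall w) = (P w)%:R.
Proof.
rewrite raddf_sum /=; under eq_bigr do rewrite mcoeff_sall sall_eq.
case: (boolP (P w)) => Pw.
  by rewrite (bigD1 w) //= eqxx big1 ?addr0 // => i /andP[_ /negPf->].
by rewrite big1 // => i Pi; case: eqP => // iw; rewrite -iw Pi in Pw.
Qed.

Lemma mcoeff_sum_sall_tag n (P : pred 'S_n) (s : Sall) : tag s != n ->
  (\sum_(p | P p) << sall p >> : KS)@_s = 0.
Proof.
move=> sn; rewrite raddf_sum big1 //= => p _; rewrite mcoeff_sall.
by case: eqP => // ps; rewrite -ps eqxx in sn.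
Qed.

Lemma classfunP n (J : finType) (cl : 'S_n -> J) (x : KS) :
  (exists c : J -> K, x = \sum_j c j *: \sum_(p | cl p == j) << sall p >>) <->
  classfun cl x.
Proof.
have E (c : J -> K) w :
    (\sum_j c j *: \sum_(p | cl p == j) << sall p >>)@_(sall w) = c (cl w).
  rewrite raddf_sum (bigD1 (cl w)) //= mcoeffZ mcoeff_sum_sall eqxx mulr1 big1.
    by rewrite addr0.
  move=> j /negPf jw.
  by rewrite mcoeffZ mcoeff_sum_sall eq_sym jw mulr0.
have E0 (c : J -> K) s : tag s != n ->
    (\sum_j c j *: \sum_(p | cl p == j) << sall p >>)@_s = 0.
  move=> sn; rewrite raddf_sum big1 //= => j _.
  by rewrite mcoeffZ mcoeff_sum_sall_tag ?mulr0.
split=> [[c ->]|[x0 xcl]].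
  by split=> [s /E0->|w w' ww'] //; rewrite !E ww'.
(* The scalar of a class is read at any of its members; an empty class has sum 0 and gets the scalar
   0. *)
exists (fun j => if [pick w | cl w == j] is Some w then x@_(sall w) else 0).
apply/malgP => s; have [sn|sn] := eqVneq (tag s) n; last by rewrite x0 ?E0.
have [w ->] := sall_tag sn; rewrite E; case: pickP => [w' /eqP /xcl //|/(_ w)].
by rewrite eqxx.
Qed.

Lemma classfunD n (J : finType) (cl : 'S_n -> J) a x y :
  classfun cl x -> classfun cl y -> classfun cl (a *: x + y).
Proof.
move=> [x0 xcl] [y0 ycl]; split=> [s sn|w w' ww'].
  by rewrite mcoeffD mcoeffZ x0 // y0 // mulr0 addr0.
by rewrite !mcoeffD !mcoeffZ (xcl _ _ ww') (ycl _ _ ww').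
Qed.

Lemma classfun0 n (J : finType) (cl : 'S_n -> J) : classfun cl 0.
Proof. by split=> [s _|w w' _]; rewrite !mcoeff0. Qed.

Lemma inDnP n (x : KS) : inDn n x <-> classfun (@Des n) x.
Proof. exact: classfunP. Qed.

Lemma inPnP n (x : KS) : inPn n x <-> classfun (@Peak n) x.
Proof. exact: classfunP. Qed.

Lemma Des_Peak n (s t : 'S_n) : Des s = Des t -> Peak s = Peak t.
Proof.
move=> st; apply/setP => i; have [i0|i0] := posnP i; first by rewrite !inE i0.
have i1 : (i.-1 < n)%N by rewrite (leq_ltn_trans (leq_pred _)).
by rewrite !(@mem_Peak _ _ _ (Ordinal i1)) ?st //= prednK.
Qed.

Lemma inPn_inDn n (x : KS) : inPn n x -> inDn n x.
Proof.
move=> /inPnP[x0 xcl]; apply/inDnP; split=> // w w' /Des_Peak; exact: xcl.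
Qed.

Lemma inner_tag n (x y : KS) : (forall s, tag s != n -> x@_s = 0) ->
  forall s, tag s != n -> (inner x y)@_s = 0.
Proof.
move=> x0 [m s] mn; rewrite -[existT _ m s]/(sall s) mcoeff_inner big1 // => p _.
by rewrite x0 ?mul0r.
Qed.

Lemma rmul_inner n (x : KS) : inDn n x -> rmul_tXi x = inner x (tXi K n).
Proof.
move=> /inDnP[x0 _]; apply/malgP => s.
have [m [w ->]] : exists m (w : 'S_m), s = sall w by case: s => m w; exists m, w.
have [mn|mn] := eqVneq m n.
  by move: w; rewrite mn => w; rewrite [RHS]mcoeff_inner [LHS]mcoeff_rmul.
rewrite [RHS]mcoeff_inner [LHS]mcoeff_rmul.
by rewrite !big1 // => p _; rewrite x0 ?mul0r.
Qed.

Lemma inner_assoc (x y z : KS) : inner x (inner y z) = inner (inner x y) z.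
Proof.
apply/malgP => s; have [m [w ->]] : exists m (w : 'S_m), s = sall w.
  by case: s => m w; exists m, w.
rewrite 2!mcoeff_inner; under eq_bigr do rewrite mcoeff_inner mulr_sumr.
under [RHS]eq_bigr do rewrite mcoeff_inner mulr_suml.
rewrite [RHS]exchange_big; apply: eq_bigr => p _ /=.
rewrite [RHS](reindex_inj (mulgI p)); apply: eq_bigr => q _ /=.
by rewrite mulKg invMg !mulgA mulrA.
Qed.
End Inner.

(** * Inner products by counting labellings *)

Section Labelled.
Variables (n : nat) (B : finType) (key : B -> nat -> nat).
Hypothesis key_inj : forall l l' a a', (a < n)%N -> (a' < n)%N ->
  key l a = key l' a' -> a = a'.

(** A function on [nat], as [std] expects; the value 0 occurs as a default only beyond the last
    position. Labels are attached to positions, not to letters. *)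
Definition lab_key (c : {ffun 'I_n -> B}) (w : 'S_n) (i : nat) : nat :=
  if insub i is Some p then key (c p) (w p) else 0.

Lemma lab_keyE c w (i : 'I_n) : lab_key c w i = key (c i) (w i).
Proof. by rewrite /lab_key valK. Qed.

Lemma lab_key_inj c w (i j : 'I_n) : lab_key c w i = lab_key c w j -> i = j.
Proof. by rewrite !lab_keyE => /key_inj e; apply/(@perm_inj _ w)/ord_inj/e. Qed.

Lemma std_lab_key_lt c w (i j : 'I_n) :
  (std n (lab_key c w) i < std n (lab_key c w) j)%N =
    (lab_key c w i < lab_key c w j)%N.
Proof.
case: (ltngtP i j) => [ij|ji|/ord_inj->]; last by rewrite !ltnn.
  rewrite std_lt // leq_eqVlt; case: eqP => // /lab_key_inj e.
  by rewrite e ltnn in ij.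
by rewrite std_gt.
Qed.

Definition lab_incr (c : {ffun 'I_n -> B}) (w : 'S_n) : bool :=
  [forall i : 'I_n, forall j : 'I_n, (i < j)%N ==> (lab_key c w i < lab_key c w
    j)%N].

(** Passing from [w] to [s^-1 * w] moves the labelled letter at position [i] to position [s i]. The
    result increases exactly when [s] ranks the positions of [w] by their keys. *)
Lemma lab_incr_std (c : {ffun 'I_n -> B}) (s w : 'S_n) :
  lab_incr [ffun i => c (s^-1%g i)] (s^-1 * w)%g = (s == std n (lab_key c w)).
Proof.
have E i : lab_key [ffun i => c (s^-1%g i)] (s^-1 * w)%g (s i) = lab_key c w i.
  by rewrite !lab_keyE ffunE permM permK.
have onto (t : 'S_n) i : exists j, i = t j by exists (t^-1%g i); rewrite permKV.
apply/forallP/eqP => [h|sE i].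
  have lt_s (i j : 'I_n) : (s i < s j)%N -> (lab_key c w i < lab_key c w j)%N.
    by move=> sij; have /forallP/(_ (s j)) := h (s i); rewrite sij !E.
  apply: perm_lt_inj => i j ij; rewrite std_lab_key_lt.
  case: (ltngtP (s i) (s j)) => [/lt_s->//|/lt_s ji|/ord_inj/perm_inj e].
    by apply/esym/negbTE; rewrite -leqNgt ltnW.
  by rewrite e ltnn in ij.
have [{}i ->] := onto s i; apply/forallP => j; have [{}j ->] := onto s j.
by rewrite !E -std_lab_key_lt -sE; apply/implyP.
Qed.

(* In a factorization w = s * t, the labels c of the positions of t are moved to
   the positions of w; then s is determined by c as the standardization of the
   keys. *)
Lemma mcoeff_inner_labelled (K : fieldType) (Q : pred {ffun 'I_n -> B})
  (x y : {malg K[Sall]}) (w : 'S_n) :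
  (forall (c : {ffun 'I_n -> B}) (s : 'S_n), Q [ffun i => c (s i)] = Q c) ->
  (forall s : 'S_n, y@_(sall s) = \sum_(c | Q c) (lab_incr c s)%:R) ->
  (inner x y)@_(sall w) = \sum_(c | Q c) x@_(sall (std n (lab_key c w))).
Proof.
move=> QP yE; rewrite mcoeff_inner.
have E (s : 'S_n) : x@_(sall s) * y@_(sall (s^-1 * w)) =
    \sum_(c | Q c) x@_(sall s) * (s == std n (lab_key c w))%:R.
  rewrite yE mulr_sumr.
  have inj : injective (fun c : {ffun 'I_n -> B} => [ffun i => c (s^-1%g i)]).
    move=> c c' /ffunP cc'; apply/ffunP => i.
    by have := cc' (s i); rewrite !ffunE permK.
  rewrite (reindex_inj inj); apply: eq_big => [c|c _]; last by rewrite lab_incr_std.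
  exact: QP.
under eq_bigr do rewrite E; rewrite exchange_big; apply: eq_bigr => c _ /=.
rewrite (bigD1 (std n (lab_key c w))) //= eqxx mulr1 big1 ?addr0 // => s /negPf->.
by rewrite mulr0.
Qed.
End Labelled.

(** * Signings compatible with a set of descents *)

Definition ord_prev n (i : 'I_n) : 'I_n :=
  Ordinal (leq_ltn_trans (leq_pred i) (ltn_ord i)).

Lemma ord_prevK n (i : 'I_n) : (0 < i)%N -> (ord_prev i).+1 = i.
Proof. exact: prednK. Qed.

(* The letters a < n with a sign e, in the order -(n-1) < ... < -0 = 0 < ... < n-1;
   both signings of the letter 0 are counted although they have the same key. *)
Definition sign_key (n : nat) (e : bool) (a : nat) : nat :=
  if e then (n - a)%N else (n + a)%N.

Lemma sign_key_inj n l l' a a' : (a < n)%N -> (a' < n)%N ->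
  sign_key n l a = sign_key n l' a' -> a = a'.
Proof. by case: l l' => -[] /=; lia. Qed.

(** [true] is the negative sign. Of two different letters the larger one dominates in absolute
    value, so its sign alone decides the comparison. *)
Lemma sign_key_lt n l l' a a' : (a < n)%N -> (a' < n)%N -> a != a' ->
  (sign_key n l a < sign_key n l' a')%N = if (a' < a)%N then l else ~~ l'.
Proof. by rewrite /sign_key; case: l l' => -[] /=; case: (ltnP a' a); lia. Qed.

(** The places where the condition that all descents lie in [D] demands an ascent, from the ordinal
    [i - 1] to [i]. *)
Definition links n (D : {set 'I_n}) : {set 'I_n} :=
  [set i : 'I_n | (0 < i)%N && (i \notin D)].

Definition peaks_near n (D : {set 'I_n}) (w : 'S_n) : bool :=
  [forall i in Peak w, (i \in D) || (ord_prev i \in D)].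

Lemma card_ffun_bool (T : finType) (A : {set T}) (g : T -> bool) :
  #|[set f : {ffun T -> bool} | [forall i in A, f i == g i]]| =
    (2 ^ (#|T| - #|A|))%N.
Proof.
pose F i : pred bool := [pred b | (i \in A) ==> (b == g i)].
rewrite (eq_card (B := family F)); last first.
  move=> f; rewrite inE; apply/forall_inP/familyP => h i.
    by rewrite inE; apply/implyP => /h.
  by move=> iA; have := h i; rewrite inE iA.
rewrite card_family foldrE big_map big_enum /=.
rewrite (bigID (mem A)) /= big1 ?mul1n => [|i iA]; last first.
  rewrite (eq_card (B := pred1 (g i))) ?card1 // => b.
  by rewrite !inE iA.
rewrite (eq_bigr (fun=> 2)) => [|i iA]; last first.
  by rewrite -[RHS]card_bool; apply: eq_card => b; rewrite !inE (negPf iA).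
rewrite prod_nat_const; congr (2 ^ _)%N.
by rewrite -(cardsC A) addKn; apply: eq_card => i; rewrite !inE.
Qed.

(* The link between positions i - 1 and i forces one sign: that of i - 1 to be
   negative at a descent, that of i to be positive at an ascent. *)
Lemma card_sign_incr n (D : {set 'I_n}) (w : 'S_n) :
  #|[set c : {ffun 'I_n -> bool} | [forall i in links D,
      lab_key (sign_key n) c w (ord_prev i) < lab_key (sign_key n) c w i]%N]| =
  (peaks_near D w * 2 ^ (n - #|links D|))%N.
Proof.
(* [phi i] is the position of the larger of the two linked letters, the one whose sign is forced. *)
pose phi (i : 'I_n) := if i \in Des w then ord_prev i else i.
have linkE (c : {ffun 'I_n -> bool}) (i : 'I_n) : (0 < i)%N ->
    (lab_key (sign_key n) c w (ord_prev i) < lab_key (sign_key n) c w i)%N =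
    (c (phi i) == (i \in Des w)).
  move=> i0; rewrite !lab_keyE sign_key_lt // -?(mem_Des _ (ord_prevK i0));
    last first.
    rewrite (inj_eq (@ord_inj n)) (inj_eq perm_inj) -val_eqE /=; lia.
  by rewrite /phi; case: ifP => _; case: (c _).
case: (boolP (peaks_near D w)) => [/forall_inP nb|]; last first.
  rewrite mul0n negb_forall_in => /exists_inP[i iP]; rewrite negb_or => /andP[iD jD].
  have i1 := Peak_gt1 iP; have i0 : (0 < i)%N by lia.
  move: iP; rewrite (mem_Peak _ (ord_prevK i0)) => /and3P[j0 jDes iDes].
  (* Both links at the peak force the sign of its top letter: the ascent to be positive, the descent
     to be negative. *)
  apply: eq_card0 => c; rewrite inE; apply/negP => /forall_inP h.
  have := h i; rewrite linkE // inE i0 iD /phi iDes => /(_ isT) /eqP ci.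
  have := h (ord_prev i); rewrite linkE // inE jD j0 /phi (negPf jDes).
  by move=> /(_ isT) /eqP; rewrite ci.
(* Two links force the sign of the same position only on the two sides of a peak, which [peaks_near]
   excludes. *)
have phi_inj : {in links D &, injective phi}.
  have key i j : i \in links D -> j \in links D -> i \in Des w ->
      j \notin Des w -> ord_prev i != j.
    move=> iL jL iDes jDes; move: iL jL; rewrite 2!inE => /andP[i0 iD] /andP[j0 jD].
    apply/eqP => ij.
    have := nb i; rewrite (mem_Peak _ (ord_prevK i0)) ij j0 jDes iDes.
    by rewrite (negPf iD) (negPf jD) => /(_ isT).
  move=> i j iL jL; rewrite /phi.
  have i0 : (0 < i)%N by move: iL; rewrite inE => /andP[].
  have j0 : (0 < j)%N by move: jL; rewrite inE => /andP[].
  case: ifPn => iDes; case: ifPn => jDes //.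
  - by move=> /(congr1 (fun k : 'I_n => k.+1)); rewrite !ord_prevK // => /ord_inj.
  - by move/eqP; rewrite (negPf (key _ _ iL jL iDes jDes)).
  - by move/esym/eqP; rewrite (negPf (key _ _ jL iL jDes iDes)).
rewrite mul1n -(card_in_imset phi_inj) -[X in (X - _)%N](card_ord n).
(* The prescribed sign at [j] is read at the only link [i] with [phi i = j]; the signs outside of
   the image of [phi] are free. *)
rewrite -(card_ffun_bool _ (fun j => [exists i in links D, (phi i == j) &&
  (i \in Des w)])).
apply: eq_card => c; rewrite !inE; apply/forall_inP/forall_inP => h i.
  case/imsetP => {}i iL ->;
    have /andP[i0 _] : (0 < i)%N && (i \notin D) by rewrite inE in iL.
  have := h i iL; rewrite linkE // => /eqP->; apply/eqP;
    apply/idP/exists_inP => [iDes|].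
    by exists i; rewrite ?eqxx.
  by case=> j jL /andP[/eqP/phi_inj->].
move=> iL; have /andP[i0 _] : (0 < i)%N && (i \notin D) by rewrite inE in iL.
rewrite linkE //; have /eqP -> := h _ (imset_f phi iL).
apply/eqP; apply/exists_inP/idP => [[j jL /andP[/eqP/phi_inj->]] //|iDes].
by exists i; rewrite ?eqxx.
Qed.

(** Comparing neighbours suffices; thus increasing signings are the case of empty [D] in
    [card_sign_incr]. *)
Lemma lab_incrE n (B : finType) (key : B -> nat -> nat) (c : {ffun 'I_n ->
  B}) (s : 'S_n) :
  lab_incr key c s =
  [forall i in links (set0 : {set 'I_n}), (lab_key key c s (ord_prev i) < lab_key
    key c s i)%N].
Proof.
apply/forallP/forall_inP => [h i|h i].
  rewrite inE => /andP[i0 _]; have /forallP/(_ i)/implyP := h (ord_prev i); apply.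
  by rewrite /= prednK.
apply/forallP => -[j jn]; apply/implyP => /=; elim: j jn => // j IHj jn.
have jn' := ltnW jn; have /= hj : (lab_key key c s j < lab_key key c s j.+1)%N.
  by have := h (Ordinal jn); rewrite !inE; apply.
rewrite ltnS leq_eqVlt => /predU1P[->//|ij]; exact: ltn_trans (IHj jn' ij) hj.
Qed.

(** * The coefficients of right multiplication by the sum of the [tXi n] *)

Section RightMul.
Variable K : fieldType.
Local Notation KS := {malg K[Sall]}.
Local Notation T := (@rmul_tXi K).

(** For [n > 0] there are [n - 1] links. The letter 0 is never the larger of two letters, so its
    sign stays free; this is the factor 2 in [tXi n]. *)
Lemma card_links0 n : (n - #|links (set0 : {set 'I_n})|)%N = (0 < n)%N.
Proof.
case: n => [|n]; first by rewrite sub0n.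
have -> : links (set0 : {set 'I_n.+1}) = ~: [set (ord0 : 'I_n.+1)].
  by apply/setP => i; rewrite !inE andbT lt0n.
by rewrite cardsC1 card_ord /= subSn // subnn.
Qed.

Lemma peaks_near0 n (w : 'S_n) : peaks_near set0 w = (Peak w == set0).
Proof.
apply/forall_inP/eqP => [h|-> i]; last by rewrite in_set0.
apply/setP => i; rewrite in_set0; apply/negP => /h.
by rewrite !in_set0.
Qed.

Lemma mcoeff_tXi n (s : 'S_n) :
  (tXi K n)@_(sall s) = (peaks_near set0 s * 2 ^ (0 < n))%:R.
Proof.
rewrite peaks_near0; case: n s => [|n] s.
  rewrite /tXi /emptyS mcoeff_sall sall_eq muln1; congr (nat_of_bool _)%:R.
  have -> : s = 1%g by apply/permP => -[].
  by rewrite eqxx; apply/esym/eqP/setP => -[].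
by rewrite mcoeffZ mcoeff_sum_sall mulrC -natrM.
Qed.

Lemma tXi_tag n s : tag s != n -> (tXi K n)@_s = 0.
Proof.
case: n => [|n] sn; last by rewrite mcoeffZ mcoeff_sum_sall_tag ?mulr0.
rewrite mcoeff_sall; case: eqP => // e; by rewrite -e in sn.
Qed.

(** By [card_sign_incr] with empty [D], [tXi n] counts increasing signings, so
    [mcoeff_inner_labelled] applies with all signings allowed. *)
Lemma mcoeff_rmul_std n (x : KS) (w : 'S_n) : (T x)@_(sall w) =
  \sum_(c : {ffun 'I_n -> bool}) x@_(sall (std n (lab_key (sign_key n) c w))).
Proof.
rewrite mcoeff_rmul -mcoeff_inner.
apply: (mcoeff_inner_labelled (@sign_key_inj n)) => // s.
rewrite mcoeff_tXi -card_links0 -card_sign_incr -sum1_card natr_sum.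
rewrite [LHS]big_mkcond; apply: eq_bigr => c _; rewrite inE lab_incrE.
by case: [forall _ in _, _].
Qed.

Lemma mcoeff_rmul_XiD n (D : {set 'I_n}) (w : 'S_n) :
  (T (XiD K D))@_(sall w) = (peaks_near D w * 2 ^ (n - #|links D|))%:R.
Proof.
rewrite mcoeff_rmul_std -card_sign_incr -sum1_card natr_sum [RHS]big_mkcond.
apply: eq_bigr => c _; rewrite mcoeff_XiD inE.
have -> : (Des (std n (lab_key (sign_key n) c w)) \subset D) =
    [forall i in links D, lab_key (sign_key n) c w (ord_prev i) < lab_key
      (sign_key n) c w i]%N.
  apply/subsetP/forall_inP => h i.
    rewrite inE => /andP[i0 iD]; have := h i; rewrite Des_std i0 /= => hi.
    rewrite ltn_neqAle leqNgt; apply/andP; split.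
      apply/eqP => e; have :=
        lab_key_inj (@sign_key_inj n) (e : lab_key _ c w (ord_prev i) = _).
      by move=> /(congr1 val) /=; lia.
    by apply: contra hi iD.
  rewrite Des_std => /andP[i0]; apply: contraLR => iD; rewrite -leqNgt ltnW //.
  by have := h i; rewrite inE i0 iD; apply.
by case: [forall _ in _, _].
Qed.

Lemma rmul_tag n (x : KS) : (forall s, tag s != n -> x@_s = 0) ->
  forall s, tag s != n -> (T x)@_s = 0.
Proof.
move=> x0 [m s] mn; rewrite -[existT _ m s]/(sall s) mcoeff_rmul big1 // => p _.
by rewrite x0 ?mul0r.
Qed.

Lemma XiD_tag n (D : {set 'I_n}) s : tag s != n -> (XiD K D)@_s = 0.
Proof. by move=> sn; apply/eqP; apply: contraNT sn => /mcoeff_XiD_tag ->. Qed.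

Lemma eq_peaks_near n (D : {set 'I_n}) w w' : Peak w =
  Peak w' -> peaks_near D w = peaks_near D w'.
Proof. by rewrite /peaks_near => ->. Qed.

Lemma rmul_XiD_inPn n (D : {set 'I_n}) : inPn n (T (XiD K D)).
Proof.
apply/inPnP; split=> [s sn|w w' ww'].
  apply: (rmul_tag (n := n)) sn; exact: XiD_tag.
by rewrite !mcoeff_rmul_XiD (eq_peaks_near _ ww').
Qed.

(** The [XiD D] span $\mathcal{D}_n$: by induction on the cardinality, [Delta D] is [XiD D] minus
    the [Delta E] with [E] properly contained in [D]. *)
Lemma inDn_ind n (P : KS -> Prop) : P 0 ->
  (forall a x y, P x -> P y -> P (a *: x + y)) ->
  (forall D : {set 'I_n}, P (XiD K D)) -> forall x, inDn n x -> P x.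
Proof.
move=> P0 PD PXi x [c ->].
have Psum (I : finType) (Q : pred I) (a : I -> K) (y : I -> KS) :
    (forall i, Q i -> P (y i)) -> P (\sum_(i | Q i) a i *: y i).
  move=> Py; elim/big_rec: _ => // i z Qi Pz; apply: PD => //; exact: Py.
apply: (Psum _ predT) => D _; have [m] := ubnP #|D|; elim: m D => // m IHm D Dm.
have -> : Delta K D = (-1) *: (\sum_(E : {set 'I_n} | E \proper D) 1 *: Delta K
  E) + XiD K D.
  have -> : XiD K D = Delta K D + \sum_(E : {set 'I_n} | E \proper D) Delta K E.
    rewrite /XiD (bigD1 D) //=; congr (_ + _).
    by apply: eq_bigl => E; rewrite properEneq andbC.
  rewrite scaleN1r addrCA addrC; under eq_bigr do rewrite scale1r.
  by rewrite addNr add0r.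
apply: PD; last exact: PXi.
by apply: Psum => E /proper_card ED; apply: IHm; apply: leq_trans ED _.
Qed.

Lemma rmul_inPn n x : inDn n x -> inPn n (T x).
Proof.
move: x; apply: inDn_ind => [|a x y|D].
- by rewrite linear0; apply/inPnP/classfun0.
- by rewrite linearP => /inPnP xP /inPnP yP; apply/inPnP/classfunD.
- exact: rmul_XiD_inPn.
Qed.

Lemma XiD_inDn n (D : {set 'I_n}) : inDn n (XiD K D).
Proof.
apply/inDnP; split=> [s|w w' ww']; first exact: XiD_tag.
by rewrite !mcoeff_XiD ww'.
Qed.
End RightMul.

(** * Triangularity and surjectivity *)

Section Weight.
Variable n : nat.
Implicit Types P Q : {set 'I_n}.

(* The order for which the expansion of T (Xi^P) is unitriangular up to a scalar. *)
Definition pweight P : nat := \sum_(i in P) (n - i).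

Lemma pweight_sub P Q : Q \subset P -> (pweight Q <= pweight P)%N.
Proof.
by move=> /setIidPr QP; rewrite /pweight [leqRHS](big_setID Q) /= QP leq_addr.
Qed.

(** As [Q] has no two adjacent elements, moving each element outside of [P] down by one maps [Q]
    injectively into [P], and every move raises the weight. If nothing moves, an element of [P]
    outside of [Q] makes the difference. *)
Lemma pweight_lt P Q :
  (forall i, i \in Q -> (0 < i)%N /\ ord_prev i \notin Q) ->
  (forall i, i \in Q -> (i \in P) || (ord_prev i \in P)) ->
  Q != P -> (pweight Q < pweight P)%N.
Proof.
move=> Qprev QP QneP; pose g i := if i \in P then i else ord_prev i.
have gP i : i \in Q -> g i \in P.
  by move=> iQ; rewrite /g; case: ifP => // iP; have := QP i iQ; rewrite iP.
have g_inj : {in Q &, injective g}.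
  move=> i j iQ jQ; rewrite /g; have [i0 iN] := Qprev i iQ;
    have [j0 jN] := Qprev j jQ.
  case: ifP => iP; case: ifP => jP //.
  - by move=> ij; rewrite -ij iQ in jN.
  - by move=> ji; rewrite ji jQ in iN.
  by move/(congr1 (fun k : 'I_n => k.+1)); rewrite !ord_prevK // => /ord_inj.
have gQ : (\sum_(i in Q) (n - g i) <= pweight P)%N.
  rewrite -(big_imset (fun i : 'I_n => (n - i)%N) g_inj); apply: pweight_sub.
  by apply/subsetP => _ /imsetP[i iQ ->]; exact: gP.
case: (boolP (Q \subset P)) => [sQP|/subsetPn[i iQ iP]].
  have /properP[_ [k kP kQ]] : Q \proper P by rewrite properEneq QneP.
  rewrite [ltnRHS]/pweight (big_setID Q) /= (setIidPr sQP) -[ltnLHS]addn0 ltn_add2l.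
  by rewrite (bigD1 k) ?inE ?kQ //= ltn_addr // subn_gt0.
apply: leq_trans gQ; rewrite /pweight (bigD1 i) //= [ltnRHS](bigD1 i) //=.
have [i0 _] := Qprev i iQ; have i_lt := ltn_ord i.
rewrite -addSn; apply: leq_add; first by rewrite /g (negPf iP) /=; lia.
by apply: leq_sum => j _; rewrite /g; case: ifP => _ /=; lia.
Qed.
End Weight.

Section Onto.
Variable K : fieldType.
Local Notation KS := {malg K[Sall]}.
Local Notation T := (@rmul_tXi K).

Lemma rmul_XiD n (D : {set 'I_n}) : T (XiD K D) =
  (2 ^ (n - #|links D|))%:R *:
  \sum_(P : {set 'I_n} | [forall i in P, (i \in D) || (ord_prev i \in D)]) Pi K P.
Proof.
apply/malgP => s; have [sn|sn] := eqVneq (tag s) n; last first.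
  rewrite (@rmul_tag _ n) //; last by move=> s'; exact: XiD_tag.
  rewrite mcoeffZ raddf_sum big1 ?mulr0 //= => P _.
  by rewrite mcoeff_sum_sall_tag.
have [w ->] := sall_tag sn; rewrite mcoeff_rmul_XiD mcoeffZ mulnC natrM.
congr (_ * _); rewrite raddf_sum /=; under eq_bigr do rewrite mcoeff_sum_sall.
rewrite /peaks_near; case: (boolP [forall _ in _, _]) => h.
  by rewrite (bigD1 (Peak w)) //= eqxx big1 ?addr0 // => P /andP[_];
    rewrite eq_sym => /negPf->.
by rewrite big1 // => P hP; case: eqP => // wP; rewrite wP hP in h.
Qed.

Lemma Pi_eq0 n (P : {set 'I_n}) : (forall w : 'S_n, Peak w != P) -> Pi K P = 0.
Proof. by move=> h; apply: big_pred0 => w; apply/negbTE. Qed.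

(** Induction on [pweight P]: up to a power of 2, invertible in characteristic 0, [T (XiD P)] is
    [Pi P] plus terms [Pi Q], each of which is 0 or has smaller weight. *)
Lemma rmul_onto n (y : KS) : [pchar K] =i pred0 -> inPn n y ->
  exists2 x, inDn n x & T x = y.
Proof.
move=> charK; pose R y := exists2 x, inDn n x & T x = y.
have R0 : R 0 by exists 0; [apply/inDnP/classfun0|rewrite linear0].
have RD a u v : R u -> R v -> R (a *: u + v).
  move=> [x /inDnP xD <-] [z /inDnP zD <-]; exists (a *: x + z).
    by apply/inDnP/classfunD.
  by rewrite linearP.
have Rsum (I : finType) (Q : pred I) (a : I -> K) (z : I -> KS) :
    (forall i, Q i -> R (z i)) -> R (\sum_(i | Q i) a i *: z i).
  move=> Rz; elim/big_rec: _ => // i u Qi Ru; apply: RD => //; exact: Rz.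
have two_neq0 m : (2 ^ m)%:R != 0 :> K.
  by have /pcharf0P -> := charK; rewrite expn_eq0.
case=> c ->; apply: (Rsum _ predT) => P _.
have [m] := ubnP (pweight P); elim: m P => // m IHm P Pm.
set ok := fun Q : {set 'I_n} => [forall i in Q, (i \in P) || (ord_prev i \in P)].
have okP : ok P by apply/forall_inP => i ->.
have -> : Pi K P = (-1) *: (\sum_(Q | ok Q && (Q != P)) 1 *: Pi K Q) +
    ((2 ^ (n - #|links P|))%:R^-1 *: T (XiD K P) + 0).
  rewrite rmul_XiD scalerA mulVf // scale1r addr0 (bigD1 P okP) /=.
  by under eq_bigr do rewrite scale1r; rewrite scaleN1r addrCA addNr addr0.
apply: (RD); last by apply: RD => //; exists (XiD K P) => //; exact: XiD_inDn.
apply: Rsum => Q /andP[/forall_inP okQ QP].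
(* If [Q] is not a peak set, [Pi Q] is 0; a peak set has no adjacent elements, as [pweight_lt]
   requires. *)
have [w /eqP wQ|noQ] := pickP (fun w : 'S_n => Peak w == Q); last first.
  by rewrite Pi_eq0 // => w; rewrite noQ.
apply: IHm; apply: leq_trans (_ : (pweight P <= m)%N); last by [].
apply: pweight_lt => // i; rewrite -wQ => iP; have i1 := Peak_gt1 iP.
have i0 : (0 < i)%N by lia.
split=> //; move: iP; rewrite (mem_Peak _ (ord_prevK i0)) => /and3P[j0 jD _].
by apply: contra jD; rewrite (mem_Peak _ (ord_prevK j0)) => /and3P[].
Qed.

Lemma dsum_onto (y : KS) : [pchar K] =i pred0 -> inP y -> exists2 x, inD x & T x = y.
Proof.
move=> charK [N [z [zP ->]]].
have zP' m : exists x, inDn m x /\ T x = z m.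
  by have [x xD xz] := rmul_onto charK (zP m); exists x.
(* [inD] asks for a function of the degree, so a preimage is chosen in every degree. *)
pose x m := proj1_sig (ClassicalEpsilon.constructive_indefinite_description _
  (zP' m)).
have xE m : inDn m (x m) /\ T (x m) = z m.
  by rewrite /x; case: ClassicalEpsilon.constructive_indefinite_description.
exists (\sum_(m < N) x m); first by exists N, x; split=> // m; case: (xE m).
by rewrite raddf_sum; apply: eq_bigr => m _; case: (xE m).
Qed.
End Onto.

(** * Closure of $\mathcal{D}_n$ under the inner product *)

Section Solomon.
Variables (K : fieldType) (n : nat) (D : {set 'I_n}).
Local Notation KS := {malg K[Sall]}.

(* c0 numbers the blocks of the composition with descent set D: it is the only
   increasing labelling with its content. *)
Let c0 : {ffun 'I_n -> 'I_n.+1} :=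
  [ffun i : 'I_n => inord #|[set d in D | d <= i]%N|].
Let rkey (l : 'I_n.+1) (a : nat) : nat := (l * n + a)%N.

Let rkey_inj l l' a a' : (a < n)%N -> (a' < n)%N -> rkey l a = rkey l' a' -> a = a'.
Proof.
by move=> an an' /(congr1 (modn^~ n)); rewrite !modnMDl !modn_small.
Qed.

Let c0E (i : 'I_n) : (0 < i)%N -> c0 i = (c0 (ord_prev i) + (i \in D))%N :> nat.
Proof.
have c_lt (k : nat) : (#|[set d in D | d <= k]%N| < n.+1)%N.
  by rewrite ltnS -[leqRHS]card_ord max_card.
move=> i0; rewrite !ffunE !inordK //.
rewrite (cardD1 i [set d in D | d <= i]%N) addnC inE leqnn andbT.
congr (_ + _)%N; apply: eq_card => d; rewrite !inE -val_eqE /=.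
by case: (d \in D); rewrite ?andbF //=; lia.
Qed.

(** Fixing the multiset of labels is invariant under permuting positions, as [mcoeff_inner_labelled]
    requires. *)
Let content (c : {ffun 'I_n -> 'I_n.+1}) : bool :=
  perm_eq [seq (c i : nat) | i <- enum 'I_n] [seq (c0 i : nat) | i <- enum 'I_n].

Let content_perm (c : {ffun 'I_n ->
  'I_n.+1}) (s : 'S_n) : content [ffun i => c (s i)] = content c.
Proof.
apply: permPl; have -> : [seq ([ffun i => c (s i)] i : nat) | i <- enum 'I_n] =
    [seq (c i : nat) | i <- [seq s i | i <- enum 'I_n]].
  by rewrite -[RHS]map_comp; apply: eq_map => i; rewrite /= ffunE.
apply/perm_map/uniq_perm.
- by rewrite (map_inj_uniq (@perm_inj _ s)) enum_uniq.
- exact: enum_uniq.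
move=> i; rewrite mem_enum; apply/mapP; exists (s^-1%g i); rewrite ?mem_enum //.
by rewrite permKV.
Qed.

Let lab_incr_sorted (c : {ffun 'I_n -> 'I_n.+1}) (s : 'S_n) : lab_incr rkey c s ->
  sorted leq [seq (c i : nat) | i <- enum 'I_n].
Proof.
move=> /forallP h.
have : sorted (fun i j : 'I_n => i < j)%N (enum 'I_n).
  have := iota_ltn_sorted 0 n; rewrite -val_enum_ord sorted_map; exact.
apply: homo_sorted => i j ij; have /forallP/(_ j) := h i.
rewrite ij !lab_keyE /rkey /=; have := ltn_ord (s i); have := ltn_ord (s j).
by case: (leqP (c i) (c j)) => //; nia.
Qed.

Let c0_sorted : sorted leq [seq (c0 i : nat) | i <- enum 'I_n].
Proof.
have : sorted (fun i j : 'I_n => i < j)%N (enum 'I_n).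
  have := iota_ltn_sorted 0 n; rewrite -val_enum_ord sorted_map; exact.
have c_lt (k : nat) : (#|[set d in D | d <= k]%N| < n.+1)%N.
  by rewrite ltnS -[leqRHS]card_ord max_card.
apply: homo_sorted => i j ij; rewrite !ffunE !inordK //.
by apply/subset_leq_card/subsetP => d; rewrite !inE => /andP[-> /= di]; lia.
Qed.

(** Between blocks the label grows and outweighs the letters; inside a block it is constant and the
    letters themselves must increase. *)
Let lab_incr_c0 (s : 'S_n) : lab_incr rkey c0 s = (Des s \subset D).
Proof.
rewrite lab_incrE; apply/forall_inP/subsetP => h i.
  move=> iDes; have i0 := Des_gt0 iDes; apply: contraLR iDes => iD.
  have iL : i \in links (set0 : {set 'I_n}) by rewrite !inE i0.
  have := h i iL; rewrite !lab_keyE /rkey (c0E i0) (negPf iD) addn0.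
  by rewrite ltn_add2l (mem_Des _ (ord_prevK i0)) -leqNgt => /ltnW.
rewrite !inE andbT => i0; rewrite !lab_keyE /rkey (c0E i0).
have := h i; rewrite (mem_Des _ (ord_prevK i0)).
have := ltn_ord (s i); have := ltn_ord (s (ord_prev i)).
case: (boolP (i \in D)) => iD /=; first by nia.
have : s i != s (ord_prev i) :> nat.
  rewrite (inj_eq (@ord_inj n)) (inj_eq perm_inj) -val_eqE /=; lia.
by case: (ltngtP (s i) (s (ord_prev i))) => // ? _ _ _;
  rewrite ?addn0 ?ltn_add2l // => /(_ isT).
Qed.

(** The labels of an increasing labelled word increase weakly, so they are determined by their
    multiset; only [c0] contributes. *)
Lemma mcoeff_XiD_content (s : 'S_n) :
  (XiD K D)@_(sall s) = \sum_(c | content c) (lab_incr rkey c s)%:R.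
Proof.
rewrite mcoeff_XiD -lab_incr_c0 (bigD1 c0) /=; last exact: perm_refl.
rewrite big1 ?addr0 // => c /andP[cc0 c_c0].
case: (boolP (lab_incr _ _ _)) => // /lab_incr_sorted sc; case/eqP: c_c0.
have := sorted_eq leq_trans anti_leq sc c0_sorted cc0 => /eq_in_map ec.
by apply/ffunP => i; apply/val_inj/ec; rewrite mem_enum.
Qed.

(** For a fixed labelling, two neighbouring keys compare as their labels do or, if these agree, as
    the letters do. The descents of the standardization therefore depend on [w] only through
    [Des w]. *)
Lemma inner_XiD_inDn x : inDn n x -> inDn n (inner x (XiD K D)).
Proof.
move=> /inDnP[x0 xcl]; apply/inDnP; split=> [|w w' ww']; first exact: inner_tag.
rewrite !(mcoeff_inner_labelled rkey_inj _ _ content_perm mcoeff_XiD_content).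
apply: eq_bigr => c _; apply: xcl; apply/setP => i; rewrite !Des_std.
case: posnP => //= i0; have /setP/(_ i) := ww'.
rewrite !(mem_Des _ (ord_prevK i0)) !(lab_keyE _ c _ i) !(lab_keyE _ c _
  (ord_prev i)) /rkey.
have := ltn_ord (w i); have := ltn_ord (w (ord_prev i)).
have := ltn_ord (w' i); have := ltn_ord (w' (ord_prev i)).
case: (ltngtP (c i) (c (ord_prev i))) => [cc|cc|->]; last by rewrite !ltn_add2l.
  have : ((c i).+1 * n <= c (ord_prev i) * n)%N by rewrite leq_mul2r cc orbT.
  by rewrite mulSnr; move: (c i * n)%N (c (ord_prev i) * n)%N; lia.
have : ((c (ord_prev i)).+1 * n <= c i * n)%N by rewrite leq_mul2r cc orbT.
by rewrite mulSnr; move: (c i * n)%N (c (ord_prev i) * n)%N; lia.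
Qed.
End Solomon.

(** * The left ideal $\mathcal{P}_n$ of $\mathcal{D}_n$ *)

Section LeftIdeal.
Variable K : fieldType.
Local Notation KS := {malg K[Sall]}.

Lemma inner_linearr a (x y z : KS) : inner x (a *: y + z) =
  a *: inner x y + inner x z.
Proof.
have innerUl s u : inner << s >> u = linext (smul K s) u by exact: linextU.
elim/malg_ind: x => [|b s x IHx]; first by rewrite !inner0l scaler0 addr0.
rewrite !inner_linearl IHx !innerUl linearD linearZ /=.
exact: scaler_exchange.
Qed.

Lemma inner0r (x : KS) : inner x 0 = 0.
Proof.
by have := inner_linearr (-1) x 0 0; rewrite scaler0 addr0 scaleN1r addNr.
Qed.

Lemma inner_inDn n (x y : KS) : inDn n x -> inDn n y -> inDn n (inner x y).
Proof.
move=> xD; move: y; apply: inDn_ind => [|a y z|D].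
- by rewrite inner0r; apply/inDnP/classfun0.
- by rewrite inner_linearr => /inDnP yD /inDnP zD; apply/inDnP/classfunD.
exact: inner_XiD_inDn.
Qed.

(** By surjectivity an element of $\mathcal{P}_n$ is [inner z (tXi n)] with [z] in $\mathcal{D}_n$;
    associativity moves [x] onto [z]. *)
Lemma inPn_left_ideal n : [pchar K] =i pred0 -> left_ideal (@inDn K n) (@inPn K n).
Proof.
move=> charK; split.
- exact: inPn_inDn.
- exact/inPnP/classfun0.
- by move=> a y z /inPnP yP /inPnP zP; apply/inPnP/classfunD.
move=> x y xD /(rmul_onto charK)[z zD <-]; rewrite (rmul_inner zD) inner_assoc.
have xzD := inner_inDn xD zD; rewrite -(rmul_inner xzD); exact: rmul_inPn.
Qed.
End LeftIdeal.

(** * Rearrangements of finite sums *)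

Lemma sum_triangle (V : nmodType) (F : nat -> nat -> V) n :
  \sum_(k < n.+1) \sum_(i < k.+1) F k i =
  \sum_(i < n.+1) \sum_(j < (n - i).+1) F (i + j)%N i.
Proof.
elim: n => [|n IHn]; first by rewrite !big_ord1 addn0.
rewrite big_ord_recr /= IHn [RHS]big_ord_recr /= subnn big_ord1 addn0.
rewrite [X in _ + X]big_ord_recr /= addrA; congr (_ + _); rewrite -big_split /=.
apply: eq_bigr => i _; have i_n : (i <= n)%N by rewrite -ltnS.
by rewrite subSn // [RHS]big_ord_recr /=; congr (_ + F _ _); lia.
Qed.

Lemma sum_triangle_swap (V : nmodType) (F : nat -> nat -> V) n :
  \sum_(i < n.+1) \sum_(j < (n - i).+1) F i j =
  \sum_(j < n.+1) \sum_(i < (n - j).+1) F i j.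
Proof.
have E (G : nat -> nat -> V) : \sum_(i < n.+1) \sum_(j < (n - i).+1) G i j =
    \sum_(k < n.+1) \sum_(i < k.+1) G i (k - i)%N.
  rewrite (sum_triangle (fun k i => G i (k - i)%N)).
  by apply: eq_bigr => i _; apply: eq_bigr => j _; rewrite addKn.
rewrite E [RHS](E (fun i j => F j i)); apply: eq_bigr => k _.
rewrite (reindex_inj rev_ord_inj); apply: eq_bigr => i _ /=.
by rewrite subSS subKn // -ltnS.
Qed.

(* Both sides run over the quadruples of sum n. *)
Lemma sum_quadruple_exchange (V : nmodType) (f : nat -> nat -> nat -> nat -> V) n :
  \sum_(k < n.+1) \sum_(i < k.+1) \sum_(j < (n - k).+1)
    f i (k - i)%N j (n - k - j)%N =
  \sum_(k < n.+1) \sum_(i < k.+1) \sum_(j < (n - k).+1)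
    f i j (k - i)%N (n - k - j)%N.
Proof.
rewrite (sum_triangle (fun k i =>
  \sum_(j < (n - k).+1) f i (k - i)%N j (n - k - j)%N)).
rewrite (sum_triangle (fun k i =>
  \sum_(j < (n - k).+1) f i j (k - i)%N (n - k - j)%N)).
apply: eq_bigr => i _.
under eq_bigr => j _ do rewrite addKn subnDA.
under [RHS]eq_bigr => j _ do rewrite addKn subnDA.
rewrite (sum_triangle_swap (fun j j' => f i j j' ((n - i) - j - j')%N)).
by apply: eq_bigr => j _; apply: eq_bigr => j' _; rewrite (subnAC (n - i)%N j j').
Qed.

Lemma mulr_exchange (R : pzRingType) (x y z t : R) :
  y * z = z * y -> x * z * (y * t) = x * y * (z * t).
Proof. by move=> yz; rewrite -!mulrA; congr (_ * _); rewrite !mulrA yz. Qed.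

(** * Composition of linear and bilinear extensions *)

Section LinextTheory.
Variable K : fieldType.

Lemma linext_comp (I J : choiceType) (V : lmodType K) (f : J -> V)
  (g : I -> {malg K[J]}) c :
  linext f (linext g c) = linext (fun i => linext f (g i)) c.
Proof.
elim/malg_ind: c => [|a i c IHc]; first by rewrite !linear0.
by rewrite !linearD !linearZ /= IHc !linextU.
Qed.

Lemma eq_linext (I : choiceType) (V : lmodType K) (f g : I -> V) :
  f =1 g -> linext f =1 linext g.
Proof. by move=> fg c; apply: eq_bigr => i _; rewrite fg. Qed.

Lemma bilext_swap (I J : choiceType) (V : lmodType K) (h : I -> J -> V) c d :
  bilext h c d = linext (fun j => linext (h^~ j) c) d.
Proof.
rewrite /bilext /linext; under eq_bigr do rewrite scaler_sumr.
under [RHS]eq_bigr do rewrite scaler_sumr.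
rewrite exchange_big; apply: eq_bigr => j _; apply: eq_bigr => i _ /=.
by rewrite !scalerA mulrC.
Qed.

Lemma bilext_linext2 (I J I' J' : choiceType) (V : lmodType K) (e : I' -> J' -> V)
  (f : I -> {malg K[I']}) (g : J -> {malg K[J']}) c d :
  bilext e (linext f c) (linext g d) = bilext (fun i j => bilext e (f i) (g j)) c d.
Proof.
rewrite {1}/bilext linext_comp; apply: eq_linext => i /=.
rewrite -[linext _ (f i)]/(bilext e (f i) (linext g d)) bilext_swap linext_comp.
by apply: eq_linext => j; rewrite [RHS]bilext_swap.
Qed.

Lemma linext_bilext (I J H : choiceType) (V : lmodType K) (k : H -> V)
  (h : I -> J -> {malg K[H]}) c d :
  linext k (bilext h c d) = bilext (fun i j => linext k (h i j)) c d.
Proof.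
by rewrite /bilext linext_comp; apply: eq_linext => i; rewrite linext_comp.
Qed.

Lemma linext_id (I : choiceType) (c : {malg K[I]}) : linext (fun i => << i >>) c = c.
Proof.
elim/malg_ind: c => [|a i c IHc]; first by rewrite linear0.
by rewrite linearD linearZ /= IHc linextU.
Qed.

Lemma bilextU (I J : choiceType) (V : lmodType K) (h : I -> J -> V) i j :
  bilext h << i >> << j >> = h i j.
Proof. by rewrite /bilext !linextU. Qed.

Lemma malg_mulE (M : monomType) (c d : {malg K[M]}) :
  c * d = bilext (fun p r => << mmul p r >>) c d.
Proof. by rewrite (bilext_linext (fun p => << p >>)) linext_id. Qed.
End LinextTheory.

(* The relation between h and t reads H(-z) t(z) = H(z) for the generating
   series, and H(z) is group-like; hence so is t(z) = H(-z)^-1 H(z). *)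
Lemma grouplike_quotient (A B : nzRingType) (j1 j2 Delta : {additive A -> B})
  (h t : nat -> A) :
  {morph j1 : x y / x * y} -> {morph j2 : x y / x * y} ->
  {morph Delta : x y / x * y} -> j1 1 = 1 -> j2 1 = 1 ->
  (forall x y, j1 x * j2 y = j2 y * j1 x) ->
  h 0%N = 1 ->
  (forall n, \sum_(k < n.+1) (-1) ^+ k * (h k * t (n - k)%N) = h n) ->
  (forall n, Delta (h n) = \sum_(k < n.+1) j1 (h k) * j2 (h (n - k)%N)) ->
  forall n, Delta (t n) = \sum_(k < n.+1) j1 (t k) * j2 (t (n - k)%N).
Proof.
move=> j1M j2M DM j11 j21 jC h0 ht Dh.
have signM (f : {additive A -> B}) k x : {morph f : x y / x * y} -> 
    f ((-1) ^+ k * x) = (-1) ^+ k * f x.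
  by move=> fM; rewrite -[in LHS]signr_odd -[in RHS]signr_odd !mulr_sign;
    case: (odd k); rewrite ?raddfN.
have signC k (x y : B) : x * ((-1) ^+ k * y) = (-1) ^+ k * (x * y).
  by rewrite -(signr_odd _ k) !mulr_sign; case: (odd k); rewrite ?mulrN.
pose d n := \sum_(k < n.+1) j1 (t k) * j2 (t (n - k)%N).
have hd n : \sum_(k < n.+1) (-1) ^+ k * (Delta (h k) * d (n - k)%N) = Delta (h n).
  (* One term for each quadruple; the sign of degree [k = i + i'] is split between the two tensor
     factors. *)
  pose f i i' j j' := ((-1) ^+ i * j1 (h i * t j)) * ((-1) ^+ i' * j2 (h i' * t j')).
  transitivity (\sum_(k < n.+1) \sum_(i < k.+1) \sum_(j < (n - k).+1)
                  f i (k - i)%N j (n - k - j)%N).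
    apply: eq_bigr => k _; rewrite Dh /d mulr_suml mulr_sumr; apply: eq_bigr => i _.
    rewrite !mulr_sumr; apply: eq_bigr => j _; rewrite /f.
    have i_k : (i <= k)%N by rewrite -ltnS.
    rewrite j1M j2M signC -[X in _ = _ * X]mulrA [RHS]mulrA -exprD subnK //.
    by congr (_ * _); rewrite -!mulrA; congr (_ * _); rewrite !mulrA jC.
  rewrite sum_quadruple_exchange Dh; apply: eq_bigr => k _.
  rewrite -[in j1 _]ht -[in j2 _]ht !raddf_sum mulr_suml; apply: eq_bigr => i _ /=.
  by rewrite mulr_sumr; apply: eq_bigr => j _ /=; rewrite !signM.
(* [Delta (t n)] and [d n] satisfy the same recursion, whose leading coefficient is [Delta 1 = 1];
   strong induction on the degree identifies them. *)
suff: forall m n, (n < m)%N -> Delta (t n) = d n by move=> E n; apply: (E n.+1).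
elim=> // m IHm n nm.
have tail (F G : 'I_n -> B) u v w : F =1 G ->
    u + \sum_i F i = w -> v + \sum_i G i = w -> u = v.
  by move=> FG; rewrite (eq_bigr G) // => <- /addIr.
have := congr1 Delta (ht n); have := hd n; rewrite !big_ord_recl /= subn0 !expr0.
rewrite !mul1r h0 mul1r raddfD raddf_sum /=.
have -> : Delta 1 = 1 by rewrite -h0 Dh big_ord1 h0 j11 j21 mulr1.
rewrite mul1r => hdn htn; apply: tail htn hdn => i.
rewrite signM // DM IHm //; have := ltn_ord i; rewrite /bump /=; lia.
Qed.

(** * The tensor square of a monoid algebra *)

Section Tensor.
Variables (K : fieldType) (M : monomType).
Local Notation A := {malg K[M]}.
Local Notation A2 := {malg K[(M * M)%type]}.

(** The algebra on [M * M] plays the part of the tensor square; [tensl] and [tensr] are $a\mapsto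
    a\otimes 1$ and $a\mapsto 1\otimes a$. *)
Definition tensl : A -> A2 := linext (fun p => << (p, mone) >>).
Definition tensr : A -> A2 := linext (fun p => << (mone, p) >>).
HB.instance Definition _ := GRing.Linear.on tensl.
HB.instance Definition _ := GRing.Linear.on tensr.

Lemma tenslM : {morph tensl : x y / x * y}.
Proof.
apply: linextM => p r; rewrite malg_mulU; congr << _ >>.
by rewrite /mmul /= /pmul /= mul1m.
Qed.

Lemma tensrM : {morph tensr : x y / x * y}.
Proof.
apply: linextM => p r; rewrite malg_mulU; congr << _ >>.
by rewrite /mmul /= /pmul /= mul1m.
Qed.

Lemma tensl1 : tensl 1 = 1. Proof. exact: linextU. Qed.
Lemma tensr1 : tensr 1 = 1. Proof. exact: linextU. Qed.

Lemma tensE (a b : A) :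
  tensl a * tensr b = bilext (fun p r => << (p, r) >>) a b :> A2.
Proof.
rewrite malg_mulE bilext_linext2 /bilext; apply: eq_linext => p;
  apply: eq_linext => r.
rewrite -[linext _ _]/(bilext _ << (p, mone) >> << (mone, r) >>) bilextU.
by congr << _ >>; rewrite /mmul /= /pmul /= mul1m mulm1.
Qed.

Lemma tensC (a b : A) : tensl a * tensr b = tensr b * tensl a.
Proof.
rewrite tensE malg_mulE bilext_linext2 bilext_swap /bilext.
apply: eq_linext => r; apply: eq_linext => p.
rewrite -[RHS]/(bilext _ << (mone, r) >> << (p, mone) >>) bilextU.
by congr << _ >>; rewrite /mmul /= /pmul /= mul1m mulm1.
Qed.

Lemma linext_tens (V : lmodType K) (g : M * M -> V) (a b : A) :
  linext g (tensl a * tensr b) = bilext (fun p r => g (p, r)) a b.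
Proof.
rewrite tensE linext_bilext /bilext; apply: eq_linext => p.
by apply: eq_linext => r; rewrite linextU.
Qed.

Section Morphism.
Variables (tau : M -> A) (delta : M -> A2).
Hypothesis tau1 : tau mone = 1.
Hypothesis tauM : forall p r, tau (mmul p r) = tau p * tau r.
Hypothesis delta1 : delta mone = 1.
Hypothesis deltaM : forall p r, delta (mmul p r) = delta p * delta r.

(** The tensor square of the linear extension of [tau]. *)
Definition tau2 : A2 -> A2 := linext (fun p => tensl (tau p.1) * tensr (tau p.2)).
HB.instance Definition _ := GRing.Linear.on tau2.

Lemma tau2M : {morph tau2 : x y / x * y}.
Proof.
apply: linextM => p r; rewrite /= !tauM tenslM tensrM.
by apply: mulr_exchange; rewrite tensC.
Qed.

(** All maps involved are multiplicative, so compatibility with the coproduct needs to be checked on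
    generators only. *)
Lemma delta_tauM p r :
  linext delta (tau p) = tau2 (delta p) -> linext delta (tau r) = tau2 (delta r) ->
  linext delta (tau (mmul p r)) = tau2 (delta (mmul p r)).
Proof.
by move=> Ep Er; rewrite tauM deltaM (linextM deltaM) Ep Er tau2M.
Qed.

Lemma delta_tau1 : linext delta (tau mone) = tau2 (delta mone).
Proof.
rewrite tau1 delta1 -[RHS]/(linext _ << _ >>) linextU /= tau1 tensl1 tensr1 mulr1.
by rewrite [LHS]linextU.
Qed.
End Morphism.
End Tensor.

(** * Compositions as sets of partial sums *)

(** Recursion on [n] with the predicate shifted by one: if 1 is to be a partial sum, a part 1 is put
    in front; otherwise the first part is enlarged by 1. *)
Lemma exists_composition n (p : pred nat) : exists2 q : composition, sumn (val q)
  = n &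
  forall i, (0 < i < n)%N -> (i \in scanl addn 0%N (val q)) = p i.
Proof.
suff [q q0 [qn qp]] : exists2 q : seq nat, 0%N \notin q & sumn q = n /\
    forall i, (0 < i < n)%N -> (i \in scanl addn 0%N q) = p i.
  by exists (Sub q q0).
elim: n p => [|n IHn] p; first by exists [::] => //; split=> // i;
  rewrite ltn0 andbF.
have [q q0 [qn qp]] := IHn (fun i => p i.+1).
have [n0|n0] := posnP n.
  by exists [:: 1%N] => //; rewrite n0; split=> // i; case: i => [|[]].
case: (boolP (p 1%N)) => p1.
  exists (1 :: q)%N; first by rewrite inE.
  split=> [|i /andP[i0 i_n]]; first by rewrite /= qn.
  rewrite /= inE mem_scanlD add0n; case: eqVneq => [->|i1] //=.
  by rewrite qp /=; [rewrite i0 subn1 prednK | lia].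
case: q q0 qn qp => [|a q] q0 qn qp; first by move: n0; rewrite -qn.
exists (a.+1 :: q); first by rewrite inE; move: q0; rewrite inE negb_or => /andP[].
split=> [|i /andP[i0 i_n]]; first by rewrite /= -qn.
have a0 : (0 < a)%N by move: q0; rewrite inE negb_or lt0n eq_sym => /andP[].
case: (eqVneq i 1%N) => [->|i1].
  rewrite (negPf p1) /= inE mem_scanlD add0n; apply/negbTE.
  by rewrite negb_or negb_and; lia.
have := qp i.-1; rewrite prednK // => <-; last by lia.
rewrite /= !inE mem_scanlD [in RHS]mem_scanlD !add0n.
have -> : (i == a.+1) = (i.-1 == a) by lia.
have -> : (a < i)%N = (a <= i.-1)%N by lia.
by have -> : (i - a.+1 = i.-1 - a)%N by lia.
Qed.

Lemma val_letter a : (0 < a)%N -> val (letter a) = [:: a].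
Proof. by move=> a0; rewrite /letter val_insubd inE eq_sym -lt0n a0. Qed.

Lemma sumn_letter a : sumn (val (letter a)) = a.
Proof.
case: a => [|a]; first by rewrite /letter val_insubd.
by rewrite val_letter //= addn0.
Qed.

Lemma composition_ind (P : composition -> Prop) : P cnil ->
  (forall a q, (0 < a)%N -> P q -> P (ccat (letter a) q)) -> forall q, P q.
Proof.
move=> P0 Pcat [s s0]; elim: s s0 => [|a s IHs] s0.
  by rewrite (_ : exist _ _ _ = cnil) //; apply: val_inj.
have := s0; rewrite inE negb_or eq_sym -lt0n => /andP[a0 s0'].
rewrite (_ : exist _ _ _ = ccat (letter a) (exist _ s s0')); first exact: Pcat.
by apply: val_inj; rewrite /= val_letter.
Qed.

(** Each block is counted at its first position. These positions are the complement of the links, so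
    the exponent of 2 in [mcoeff_rmul_XiD] becomes the number of parts. *)
Lemma sum_partial_sums (q : seq nat) : 0%N \notin q ->
  (\sum_(0 <= i < sumn q) ((i == 0) || (i \in scanl addn 0 q)) = size q)%N.
Proof.
elim: q => [|a q IHq] /=; first by rewrite big_geq.
rewrite inE negb_or eq_sym -lt0n => /andP[a0 q0].
rewrite (@big_cat_nat _ _ _ a) ?leq_addr //= -add1n; congr (_ + _)%N.
  rewrite big_ltn // eqxx big_nat big1 ?addn0 // => i /andP[i0 ia].
  rewrite inE mem_scanlD add0n (gtn_eqF i0) (ltn_eqF ia).
  by have -> : (a <= i)%N = false by lia.
rewrite -{1}[a]add0n big_addn addKn -[RHS]IHq //.
apply: eq_big_nat => i _; rewrite inE mem_scanlD add0n leq_addl addnK.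
by congr (nat_of_bool _);
  rewrite addn_eq0 (gtn_eqF a0) andbF /= -{2}[a]add0n eqn_add2r.
Qed.

Lemma peaks_near_std n (D : {set 'I_n}) (q v : seq nat) : size v = n ->
  (forall i : 'I_n, (0 < i)%N -> (i \in D) = ((i : nat) \in scanl addn 0%N q)) ->
  peaks_near D (std n (nth 0%N v)) = peakless_blocks q v.
Proof.
move=> vn Dq; have peakE (i : 'I_n) : (i \in Peak (std n (nth 0%N v))) =
    [&& 1 < i, nth 0 v i.-2 <= nth 0 v i.-1 & nth 0 v i < nth 0 v i.-1]%N.
  have [i0|i0] := posnP i; first by rewrite inE i0.
  rewrite (mem_Peak _ (ord_prevK i0)) !Des_std i0.
  have -> : (0 < ord_prev i)%N = (1 < i)%N by rewrite /=; lia.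
  by case: ltnP => //= i1; rewrite -leqNgt.
have E (i : 'I_n) : (1 < i)%N -> (i \in D) || (ord_prev i \in D) =
    ((i : nat) \in scanl addn 0%N q) || (i.-1 \in scanl addn 0%N q).
  by move=> i1; rewrite !Dq //=; lia.
rewrite /peakless_blocks vn; apply: eq_forallb => i; rewrite peakE.
by case: ltnP => //= i1; rewrite E.
Qed.

Lemma sorted_blocks_nil q : sorted_blocks q [::].
Proof. by apply/sorted_blocksP => i; rewrite ltn0 andbF. Qed.

Lemma peakless_blocks_nil q : peakless_blocks q [::].
Proof. by apply/peakless_blocksP => i; rewrite ltn0 andbF. Qed.

(** * The image of [Xi q], and the alternating relation on words *)

Section Assembly.
Variable K : fieldType.
Local Notation KS := {malg K[Sall]}.
Local Notation A := {malg K[composition]}.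
Local Notation L := (linext (@Xi K)).
Local Notation T := (@rmul_tXi K).

(** Membership is compared at positive positions, the only ones where a descent can occur. *)
Lemma XiD_Xi n (D : {set 'I_n}) (q : composition) : sumn (val q) = n ->
  (forall i : 'I_n, (0 < i)%N -> (i \in D) =
    ((i : nat) \in scanl addn 0%N (val q))) ->
  XiD K D = Xi K q.
Proof.
move=> qn; case: _ / qn D => D Dq; rewrite /Xi !XiDE; apply: eq_bigl => s.
apply/subsetP/subsetP => h i iD; have i0 := Des_gt0 iD.
  by rewrite inE -Dq // h.
by rewrite Dq //; have := h i iD; rewrite inE.
Qed.

Lemma inDn_span n (x : KS) : inDn n x -> exists c : A, x = L c.
Proof.
move: x; apply: inDn_ind => [|a _ _ [c ->] [d ->]|D].
- by exists 0; rewrite linear0.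
- by exists (a *: c + d); rewrite linearP.
pose p i := [exists j : 'I_n, (j == i :> nat) && (j \in D)].
have [q qn qp] := exists_composition n p; exists << q >>.
rewrite linextU; apply: XiD_Xi => // i i0; rewrite qp ?i0 //=.
by apply/idP/existsP => [iD|[j /andP[/eqP/ord_inj->]]//]; exists i; rewrite eqxx.
Qed.

Lemma inD_span (x : KS) : inD x -> exists c : A, x = L c.
Proof.
case=> N [y [yD ->]]; elim: N => [|N [c IHN]]; first by exists 0;
  rewrite big_ord0 linear0.
have [d dE] := inDn_span (yD N); exists (c + d).
by rewrite big_ord_recr /= dE IHN linearD.
Qed.

Lemma wcoeff_rmul_Xi (q : composition) v : wcoeff (T (Xi K q)) v =
  ((size v == sumn (val q)) && peakless_blocks (val q) v)%:R * (2 ^ size (val q))%:R.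
Proof.
rewrite /wcoeff; case: eqP => [vq|/eqP vq] /=; last first.
  rewrite (@rmul_tag _ (sumn (val q))) ?mul0r // => s; exact: XiD_tag.
rewrite /Xi -vq mcoeff_rmul_XiD natrM; congr (_%:R * (2 ^ _)%:R).
  by rewrite (peaks_near_std (erefl _) (q := val q)) // => i _; rewrite inE.
rewrite -(sum_partial_sums (valP q)) -vq big_mkord -[X in (X - _)%N]card_ord.
rewrite -(cardsC (links (Dcomp (size v) (val q)))) addKn -sum1_card
  [LHS]big_mkcond; apply: eq_bigr => i _.
by rewrite !inE negb_and negbK -eqn0Ngt; case: (_ || _).
Qed.

Lemma wcoeff_tXi n v : wcoeff (tXi K n) v =
  ((size v == n) && peakless_blocks [::] v)%:R * (2 ^ (0 < n))%:R.
Proof.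
rewrite /wcoeff; case: eqP => [vn|/eqP vn] /=; last by rewrite tXi_tag ?mul0r.
rewrite -vn mcoeff_tXi natrM (peaks_near_std (erefl _) (q := [::])) // => i _.
by rewrite in_set0 in_nil.
Qed.

Lemma tXi_inPn n : inPn n (tXi K n).
Proof.
apply/inPnP; split=> [s|w w' ww']; first exact: tXi_tag.
by rewrite !mcoeff_tXi (eq_peaks_near _ ww').
Qed.

(** The representative of [tXi n] in the free algebra; it exists because
    $\mathcal{P}_n\subseteq\mathcal{D}_n$. *)
Definition alg_tXi (n : nat) : A := coefs (@Xi K) (tXi K n).

Lemma linext_alg_tXi n : L (alg_tXi n) = tXi K n.
Proof.
have [c cE] := inDn_span (inPn_inDn (tXi_inPn n)).
by rewrite /alg_tXi cE (coefsK (@Xi_free K)).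
Qed.

Definition alg_tXiq (q : composition) : A := \prod_(a <- val q) alg_tXi a.

Lemma alg_tXiq_cat p q : alg_tXiq (ccat p q) = alg_tXiq p * alg_tXiq q.
Proof. exact: big_cat. Qed.

Lemma alg_tXiq_nil : alg_tXiq cnil = 1.
Proof. exact: big_nil. Qed.

Lemma alg_tXi0 : alg_tXi 0 = 1.
Proof.
apply: (@Xi_free K); rewrite linext_alg_tXi [RHS]linextU; apply: wcoeff_inj => v.
rewrite wcoeff_tXi wcoeff_Xi mulr1 /=; case: v => //=.
by rewrite peakless_blocks_nil sorted_blocks_nil.
Qed.

Lemma alg_tXiq_letter a : alg_tXiq (letter a) = alg_tXi a.
Proof.
case: a => [|a]; first by rewrite alg_tXi0 /letter /alg_tXiq val_insubd /= big_nil.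
by rewrite /alg_tXiq val_letter // big_seq1.
Qed.

Lemma linext_alg_tXiq q : L (alg_tXiq q) = tXiq K q.
Proof.
rewrite /alg_tXiq /tXiq; elim: (val q) => [|a s IHs].
  by rewrite !big_nil -[emptyS K]/(tXi K 0) -linext_alg_tXi alg_tXi0.
by rewrite !big_cons -IHs -linext_alg_tXi star_linext.
Qed.

(** Induction on the word [q]: the peak condition and the power of 2 both factor over the first
    block and the rest, and in the deconcatenation formula only the cut after the first block
    survives. *)
Lemma rmul_Xi q : T (Xi K q) = L (alg_tXiq q).
Proof.
elim/composition_ind: q => [|a q a0 IHq].
  rewrite alg_tXiq_nil [RHS]linextU; apply: wcoeff_inj => v.
  rewrite wcoeff_rmul_Xi wcoeff_Xi mulr1 /=; case: v => //=.
  by rewrite peakless_blocks_nil sorted_blocks_nil.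
rewrite alg_tXiq_cat alg_tXiq_letter; apply: wcoeff_inj => v;
  rewrite wcoeff_mul -IHq linext_alg_tXi.
have q0 : 0%N \notin a :: val q by rewrite inE negb_or eq_sym -lt0n a0 (valP q).
rewrite wcoeff_rmul_Xi /= val_letter //=.
have [av|av] := leqP a (size v); last first.
  have -> : (size v == a + sumn (val q))%N = false by lia.
  rewrite mul0r big1 // => k _; rewrite wcoeff_tXi size_takel -1?ltnS //.
  by have -> : (k == a :> nat) = false; [have := ltn_ord k; lia | rewrite !mul0r].
rewrite (bigD1 (Ordinal (av : (_ < _.+1)%N))) //= big1 ?addr0 => [|k ka].
  rewrite wcoeff_tXi wcoeff_rmul_Xi size_takel // eqxx size_drop a0 /=.
  rewrite peakless_blocks_cons // expnS natrM.
  have -> : (size v == a + sumn (val q))%N = (size v - a == sumn (val q))%N by lia.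
  rewrite andbCA -mulnb natrM -!mulrA; congr (_ * _).
  by rewrite mulrCA.
rewrite wcoeff_tXi size_takel -1?ltnS //.
by move: ka; rewrite -val_eqE /= => /negPf->; rewrite !mul0r.
Qed.

(** In the free model, [T] becomes the algebra endomorphism that substitutes [alg_tXi a] for each
    letter [a]. *)
Lemma rmul_linext (c : A) : T (L c) = L (linext alg_tXiq c).
Proof.
rewrite [RHS]linext_comp -[T _]/(linext _ _) linext_comp; apply: eq_linext => q.
exact: rmul_Xi.
Qed.

Lemma sorted_blocks0 v : sorted_blocks [::] v = sorted leq v.
Proof.
apply/sorted_blocksP/(sortedP 0%N) => h i.
  by move=> iv; have := h i.+1; rewrite in_nil; apply.
by case: i => //= i iv _; apply: h.
Qed.

Lemma sorted_blocks_letter k v : size v = k -> sorted_blocks (val (letter k)) v =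
  sorted leq v.
Proof.
case: k => [|k] vk; first by rewrite (size0nil vk) sorted_blocks_nil.
rewrite -sorted_blocks0 val_letter //;
  apply/sorted_blocksP/sorted_blocksP => h i /andP[i0 iv].
  by move=> _; apply: h; rewrite ?i0 // inE add0n -vk ltn_eqF.
by move=> _; apply: h; rewrite ?i0.
Qed.

(** After an ascent the first descent would complete a peak, so none can follow. *)
Lemma peakless_up a b v : (a <= b)%N -> peakless_blocks [::] [:: a, b & v] =
  sorted leq (b :: v).
Proof.
move=> ab; apply/peakless_blocksP/(sortedP 0%N) => /= h.
  elim=> [|i IHi] iv.
    by rewrite leqNgt; apply/negP => vb; have := h 2 iv ab vb.
  have hi := IHi (ltnW iv); rewrite leqNgt; apply/negP => lt_i.
  by have := h i.+3 iv hi lt_i.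
case=> [|[|i]] //= iv _; rewrite ltnNge.
by rewrite (h i).
Qed.

Lemma peakless_down a b v : (b < a)%N -> peakless_blocks [::] [:: a, b & v] =
  peakless_blocks [::] (b :: v).
Proof.
move=> ba; apply/peakless_blocksP/peakless_blocksP => h i /andP[i1 iv].
  by case: i i1 iv => [|[|i]] //= _ iv v1 v2; apply: (h i.+3).
case: i i1 iv => [|[|[|i]]] //= _ iv v1 v2; first by rewrite leqNgt ba in v1.
exact: (h i.+2).
Qed.

Let tval (v : seq nat) : K := (peakless_blocks [::] v)%:R * (2 ^ (0 < size v))%:R.

(** Induction on the word [a, b, ...]. The terms with [k > 0] are, up to sign, those of the word
    without [a]. If [a <= b] they sum to minus the right-hand side, and the term [k = 0] is twice
    it. If [b < a] only the first of them survives, and it cancels the term [k = 0]. *)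
Lemma alternating_sum v :
  \sum_(k < (size v).+1) (-1) ^+ k * ((sorted leq (take k v))%:R * tval (drop k v)) =
  (sorted leq v)%:R.
Proof.
elim: v => [|a [|b v] IHv].
- by rewrite big_ord1 /tval peakless_blocks_nil !mul1r.
- rewrite !big_ord_recl big_ord0 /tval /= peakless_blocks_nil /bump /= expr0
  expr1 !mul1r addr0.
  have -> : peakless_blocks [::] [:: a] by apply/peakless_blocksP => -[|[]].
  by rewrite mul1r mulr1 (natrD _ 1 1) addrK.
rewrite big_ord_recl take0 drop0 expr0 !mul1r /=.
have E (k : 'I_(size v).+2) : (-1) ^+ bump 0 k *
    ((path leq a (take k (b :: v)))%:R * tval (drop k (b :: v))) =
    - ((-1) ^+ k * (((k == 0%N :> nat) || (a <= b)%N)%:R *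
        ((sorted leq (take k (b :: v)))%:R * tval (drop k (b :: v))))).
  rewrite /bump add1n exprS mulN1r mulNr; congr (- (_ * _)).
  by case: k => -[|k] //= kv; rewrite ?mul1r // -mulnb natrM mulrA.
under eq_bigr do rewrite E; rewrite sumrN; case: (leqP a b) => ab.
  under eq_bigr do rewrite orbT mul1r; rewrite IHv /tval peakless_up //=.
  by rewrite expn1 mulr_natr mulr2n addrK.
rewrite big_ord_recl big1 ?addr0 /= => [|i _]; last by rewrite mul0r mulr0.
by rewrite expr0 !mul1r /tval peakless_down // subrr.
Qed.
End Assembly.

(** * Compatibility with the coproduct *)

Section Bialgebra.
Variable K : fieldType.
Local Notation KS := {malg K[Sall]}.
Local Notation A := {malg K[composition]}.
Local Notation A2 := {malg K[(composition * composition)%type]}.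
Local Notation L := (linext (@Xi K)).
Local Notation L2 := (linext (@Xi2 K)).
Local Notation T := (@rmul_tXi K).

Lemma wcoeff_linext_signs (M : monomType) (h : M -> KS) n (x : nat ->
  {malg K[M]}) v :
  wcoeff (linext h (\sum_(k < n) (-1) ^+ k * x k)) v =
  \sum_(k < n) (-1) ^+ k * wcoeff (linext h (x k)) v.
Proof.
rewrite raddf_sum /wcoeff raddf_sum; apply: eq_bigr => k _ /=.
rewrite -[in LHS]signr_odd -[in RHS]signr_odd !mulr_sign.
by case: (odd k); rewrite // raddfN mcoeffN.
Qed.

Lemma wcoeff_letter k v :
  wcoeff (Xi K (letter k)) v = ((size v == k) && sorted leq v)%:R.
Proof.
by rewrite wcoeff_Xi sumn_letter; case: eqP => //= vk; rewrite sorted_blocks_letter.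
Qed.

(** This is $H(-z)\,t(z)=H(z)$ in degree [n]. Since [Xi] is free it can be tested on words, where
    the cut at [k] alone survives and [alternating_sum] concludes. *)
Lemma alternating_alg_tXi n :
  \sum_(k < n.+1) (-1) ^+ k * (<< letter k >> * alg_tXi K (n - k)) =
    << letter n >> :> A.
Proof.
apply: (@Xi_free K); apply: wcoeff_inj => v.
rewrite [linext _ << letter n >>]linextU wcoeff_letter.
transitivity (\sum_(k < n.+1) (-1) ^+ k *
    wcoeff (L (<< letter k >> * alg_tXi K (n - k))) v).
  exact: (wcoeff_linext_signs (@Xi K) n.+1 (fun k =>
    << letter k >> * alg_tXi K (n - k))).
have E (k : 'I_n.+1) : wcoeff (L (<< letter k >> * alg_tXi K (n - k))) v =
    (size v == n)%:R * ((sorted leq (take k v))%:R *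
      ((peakless_blocks [::] (drop k v))%:R * (2 ^ (0 < size (drop k v))%N)%:R)).
  rewrite wcoeff_mul [L << _ >>]linextU linext_alg_tXi.
  have [kv|kv] := ltnP k (size v).+1; last first.
    have -> : (size v == n) = false by have := ltn_ord k; lia.
    rewrite mul0r big1 // => j _; rewrite wcoeff_letter size_takel -1?ltnS //.
    by have -> : (j == k :> nat) = false; [have := ltn_ord j; lia | rewrite mul0r].
  rewrite (bigD1 (Ordinal kv)) //= big1 ?addr0 => [|j jk].
    rewrite wcoeff_letter size_takel -1?ltnS // eqxx wcoeff_tXi size_drop.
    have -> : (size v - k == n - k)%N = (size v == n).
      by have := ltn_ord k; lia.
    case: eqP => [->|] /=; last by rewrite !mul0r mulr0.
    by rewrite mul1r.
  rewrite wcoeff_letter size_takel -1?ltnS //.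
  by move: jk; rewrite -val_eqE /= => /negPf->; rewrite mul0r.
under eq_bigr do rewrite E.
case: eqP => [vn|_]; last by rewrite big1 // => k _; rewrite mul0r mulr0.
rewrite -alternating_sum vn; apply: eq_bigr => k _.
by rewrite mul1r.
Qed.

(** The coproduct of the free algebra on letters; [down_linext] identifies its multiplicative
    extension with [down]. *)
Definition alg_down1 (n : nat) : A2 :=
  \sum_(k < n.+1) << (letter k, letter (n - k)) >>.
Definition alg_down (q : composition) : A2 := \prod_(a <- val q) alg_down1 a.

Lemma alg_down_cat p q : alg_down (ccat p q) = alg_down p * alg_down q.
Proof. exact: big_cat. Qed.

Lemma alg_down_nil : alg_down cnil = 1.
Proof. exact: big_nil. Qed.

Lemma letter0 : letter 0 = cnil.
Proof. by apply: val_inj; rewrite /letter val_insubd. Qed.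

Lemma alg_down_letter a : alg_down (letter a) = alg_down1 a.
Proof.
case: a => [|a]; last by rewrite /alg_down val_letter // big_seq1.
by rewrite letter0 alg_down_nil /alg_down1 big_ord1 letter0.
Qed.

Lemma tensU (M : monomType) (p r : M) :
  tensl << p >> * tensr << r >> = << (p, r) >> :> {malg K[(M * M)%type]}.
Proof. by rewrite tensE bilextU. Qed.

Lemma alg_down_tXi n :
  linext alg_down (alg_tXi K n) =
    \sum_(k < n.+1) tensl (alg_tXi K k) * tensr (alg_tXi K (n - k)).
Proof.
apply: (@grouplike_quotient A A2 (@tensl K composition) (@tensr K composition)
  (linext alg_down) (fun k => << letter k >>)).
- exact: tenslM.
- exact: tensrM.
- exact: linextM alg_down_cat.
- exact: tensl1.
- exact: tensr1.
- exact: tensC.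
- by rewrite letter0.
- exact: alternating_alg_tXi.
move=> m; transitivity (alg_down (letter m)); first exact: linextU.
rewrite alg_down_letter; apply: eq_bigr => k _.
exact/esym/tensU.
Qed.

(** On a single letter this is the group-like property [alg_down_tXi]; both sides are multiplicative
    in [q]. *)
Lemma alg_down_tXiq q : linext alg_down (alg_tXiq K q) =
  tau2 (@alg_tXiq K) (alg_down q).
Proof.
elim/composition_ind: q => [|a q _ IHq].
  exact: (delta_tau1 (alg_tXiq_nil K) alg_down_nil).
apply: (delta_tauM (@alg_tXiq_cat K) alg_down_cat) IHq.
rewrite alg_tXiq_letter alg_down_letter alg_down_tXi [RHS]raddf_sum;
  apply: eq_bigr => k _.
by rewrite /tau2 [RHS]linextU /= !alg_tXiq_letter.
Qed.

Lemma Xi_nil : Xi K cnil = emptyS K.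
Proof. by rewrite -[RHS]/(tXi K 0) -linext_alg_tXi alg_tXi0 [RHS]linextU. Qed.

Lemma tens_linext (c d : A) : L2 (tensl c * tensr d) = tens (L c) (L d).
Proof. by rewrite [LHS]linext_tens [RHS]bilext_linext2. Qed.

Lemma down_linext (c : A) : down (L c) = L2 (linext alg_down c).
Proof.
rewrite [RHS]linext_comp /down (coefsK (@Xi_free K)); apply: eq_linext => q.
have L2delta n : L2 (alg_down1 n) = down1 K n.
  by rewrite raddf_sum; apply: eq_bigr => k _; exact: linextU.
rewrite /alg_down; elim: (val q) => [|a s IHs].
  by rewrite !big_nil [RHS]linextU -Xi_nil.
rewrite !big_cons IHs -[down1 K a]L2delta; exact: star2_linext.
Qed.

Lemma tensmap_linear (k : Sall -> KS) (x y : KS) :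
  tensmap (linext k) (linext k) (tens x y) = tens (linext k x) (linext k y).
Proof.
rewrite [LHS]linext_bilext [RHS]bilext_linext2; apply: eq_linext => s.
by apply: eq_linext => t; rewrite !linextU.
Qed.

Lemma tensmap_linext (z : A2) : tensmap T T (L2 z) = L2 (tau2 (@alg_tXiq K) z).
Proof.
rewrite [LHS]linext_comp [RHS]linext_comp; apply: eq_linext => -[p r].
rewrite [RHS]tens_linext -!rmul_Xi /=.
exact: tensmap_linear.
Qed.
End Bialgebra.

(** * The bialgebra epimorphism and its consequences *)

Lemma rmul_star (K : fieldType) (x y : {malg K[Sall]}) : inD x -> inD y ->
  rmul_tXi (star x y) = star (rmul_tXi x) (rmul_tXi y).
Proof.
move=> /inD_span[c ->] /inD_span[d ->].
rewrite star_linext !rmul_linext star_linext; congr (linext _ _).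
exact: (linextM (@alg_tXiq_cat K)).
Qed.

Lemma down_rmul (K : fieldType) (x : {malg K[Sall]}) : inD x ->
  down (rmul_tXi x) = tensmap (@rmul_tXi K) (@rmul_tXi K) (down x).
Proof.
move=> /inD_span[c ->]; rewrite rmul_linext !down_linext tensmap_linext.
congr (linext _ _); rewrite [LHS]linext_comp [RHS]linext_comp.
by apply: eq_linext => q; exact: alg_down_tXiq.
Qed.

Lemma counit_rmul (K : fieldType) (x : {malg K[Sall]}) :
  counit (rmul_tXi x) = counit x.
Proof.
rewrite /counit mcoeff_rmul (bigD1 1%g) //= big1 ?addr0 => [|s s1].
  by rewrite mcoeff_sall sall_eq invg1 mulg1 eqxx mulr1.
(* The group ['S_0] has only one element. *)
by case/eqP: s1; apply/permP => -[].
Qed.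

Lemma rmul_graded_bialgebra_epi (K : fieldType) : [pchar K] =i pred0 ->
  graded_bialgebra_epi (@rmul_tXi K).
Proof.
move=> charK; split.
- exact: rmul_inPn.
- by move=> y; exact: dsum_onto.
- exact: rmul_star.
- by rewrite -Xi_nil [LHS]rmul_Xi alg_tXiq_nil; exact: linextU.
- exact: down_rmul.
by move=> x _; exact: counit_rmul.
Qed.

Theorem theorem5 (K : fieldType) (charK : [pchar K] =i pred0) :
  [/\ (forall n (x : {malg K[Sall]}),
         inDn n x -> rmul_tXi x = inner x (tXi K n)),
      graded_bialgebra_epi (@rmul_tXi K),
      (forall n (y : {malg K[Sall]}),
         inPn n y <-> exists2 x, inDn n x & y = inner x (tXi K n)),
      (forall n, left_ideal (@inDn K n) (@inPn K n)) &
      (forall n (q : composition), sumn (val q) = n ->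
         tXiq K q = inner (Xi K q) (tXi K n))].
Proof.
split.
- exact: rmul_inner.
- exact: rmul_graded_bialgebra_epi.
- move=> n y; split=> [/(rmul_onto charK)[x xD <-]|[x xD ->]].
    by exists x; [exact: xD | exact: rmul_inner xD].
  by rewrite -(rmul_inner xD); exact: rmul_inPn.
- by move=> n; exact: inPn_left_ideal.
move=> _ q <-; rewrite -linext_alg_tXiq -rmul_Xi; apply: rmul_inner.
exact: XiD_inDn.
Qed.
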